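(* For all $\alpha\in(0,1)$, $\mu\in(0,1/3)$ and integers $\ell,k\geq 2$, there is an $n_0$ such that the following holds for all $n\geq n_0$. Suppose $H$ is an $(\alpha,\ell_0)$-connected $k$-graph on $n$ vertices for some integer $\ell_0\geq k+1$ with $$180k\,\frac{\ell_0}{\alpha}\,\log\frac{\ell_0}{\alpha}\,\log\frac{1}{\mu}\leq \ell .$$ Then there is a fractional $C^k_{\ell}$-decomposition $\omega$ of $H$ with $$(1-\mu)\frac{2e(H)}{\Delta(H)^{\ell}}\leq\omega(C)\leq (1+\mu)\frac{2e(H)}{\delta(H)^{\ell}}$$ for all $\ell$-cycles $C$ in $H$.
   Context: A $k$-graph $H$ has a finite vertex set $V(H)$ and a set $E(H)$ of edges, each a $k$-element subset of $V(H)$; $e(H):=|E(H)|$. For a $(k-1)$-set $x\subseteq V(H)$, the degree $d(x)$ is the number of edges containing $x$; $\delta(H)$ and $\Delta(H)$ denote the minimum and maximum of $d(x)$ over all $(k-1)$-subsets $x$ of $V(H)$. $\log$ is the natural logarithm. The (tight) cycle $C_\ell^k$ of length $\ell$ is the $k$-graph on $\ell$ vertices whose vertex set can be cyclically ordered such that a $k$-set forms an edge if and only if its elements appear consecutively in this ordering. An $\ell$-cycle in $H$ is a subgraph of $H$ isomorphic to $C_\ell^k$; $\mathcal{C}_\ell(H)$ is the set of $\ell$-cycles in $H$. A fractional $C_\ell^k$-decomposition of $H$ is a function $\omega\colon\mathcal{C}_\ell(H)\to[0,1]$ with $\sum_{C\in\mathcal{C}_\ell(H)\colon e\in E(C)}\omega(C)=1$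 for all $e\in E(H)$. Let $\vec{E}(H)$ be the set of tuples $(v_1,\ldots,v_k)\in V(H)^k$ with $\{v_1,\ldots,v_k\}\in E(H)$, and $\vec{e}(H):=|\vec{E}(H)|$. A walk of length $m$ in $H$ is a sequence $\vec{e}_1\ldots\vec{e}_m$ of elements of $\vec{E}(H)$ such that there is a sequence $v_1\ldots v_{m+k-1}$ of vertices with $\vec{e}_i=(v_i,\ldots,v_{i+k-1})$ for all $i\in\{1,\dots,m\}$; it is a walk from $\vec{e}_1$ to $\vec{e}_m$. A $k$-graph $H$ on $n$ vertices is $(\alpha,m)$-connected if for all $\vec{e},\vec{f}\in\vec{E}(H)$ there are at least $\alpha n^{m-1}/\vec{e}(H)$ walks of length $m$ from $\vec{e}$ to $\vec{f}$ in $H$. *)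

(* Defs.v *)
From HB Require Import structures.
From mathcomp Require Import all_boot all_order all_algebra.
From mathcomp Require Import reals exp.

Set Implicit Arguments.
Unset Strict Implicit.
Unset Printing Implicit Defensive.

Import Order.TTheory GRing.Theory Num.Theory.
Local Open Scope ring_scope.

(* The first component is the vertex set (a subset of the ambient finite type
   T) and the second one the edge set; keeping the vertex set explicit makes
   the subgraphs of a k-graph k-graphs over the same ambient type. *)
Record kgraph (T : finType) (k : nat) := KGraph {
  kgraph_val : {set T} * {set {set T}};
  _ : [forall e in kgraph_val.2, (e \subset kgraph_val.1) && (#|e| == k)]
}.

HB.instance Definition _ (T : finType) (k : nat) :=
  [isSub for @kgraph_val T k].
HB.instance Definition _ (T : finType) (k : nat) :=
  [Finite of kgraph T k by <:].

Definition vertices (T : finType) (k : nat) (H : kgraph T k) : {set T} :=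
  (kgraph_val H).1.

Definition edges (T : finType) (k : nat) (H : kgraph T k) : {set {set T}} :=
  (kgraph_val H).2.

Definition subgraph (T : finType) (k : nat) (G H : kgraph T k) : bool :=
  (vertices G \subset vertices H) && (edges G \subset edges H).

Definition degree (T : finType) (k : nat) (H : kgraph T k) (x : {set T}) : nat :=
  #|[set e in edges H | x \subset e]|.

(* The neutral element #|edges H| is an upper bound of all degrees, so this is
   the true minimum as soon as vertices H has a subset of size k - 1. *)
Definition min_degree (T : finType) (k : nat) (H : kgraph T k) : nat :=
  \big[minn/#|edges H|]_(x : {set T} | (x \subset vertices H) && (#|x| == k.-1))
    degree H x.

Definition max_degree (T : finType) (k : nat) (H : kgraph T k) : nat :=
  (\max_(x : {set T} | (x \subset vertices H) && (#|x| == k.-1)) degree H x)%N.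

(* C is isomorphic to the tight cycle of length l: v is the cyclic ordering of
   the vertices of C, and ordS is the cyclic successor on 'I_l. *)
Definition tight_cycle (T : finType) (k l : nat) (C : kgraph T k) : bool :=
  [exists v : {ffun 'I_l -> T},
    [&& injectiveb v,
        vertices C == [set v i | i : 'I_l] &
        edges C == [set e : {set T} | (#|e| == k) &&
          [exists i : 'I_l, e == [set v (iter j (@ordS l) i) | j : 'I_k]]]]].

Definition cycles (T : finType) (k l : nat) (H : kgraph T k) :
    {set kgraph T k} :=
  [set C | subgraph C H && tight_cycle l C].

(* Only the values of w on cycles l H are relevant. *)
Definition fractional_cycle_decomposition (R : realType) (T : finType)
    (k l : nat) (H : kgraph T k) (w : kgraph T k -> R) : Prop :=
  (forall C, C \in cycles l H -> 0 <= w C <= 1) /\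
  (forall e, e \in edges H ->
    \sum_(C in cycles l H | e \in edges C) w C = 1).

Definition oriented_edges (T : finType) (k : nat) (H : kgraph T k) :
    {set k.-tuple T} :=
  [set t : k.-tuple T | [set x in t] \in edges H].

(* The vertex sequence v has length m + k - 1, and take k (drop i v) is its
   window of k entries starting at position i (counting from 0). *)
Definition walks (T : finType) (k : nat) (H : kgraph T k) (m : nat) :
    {set m.-tuple (k.-tuple T)} :=
  [set w : m.-tuple (k.-tuple T) |
    [forall i : 'I_m, tnth w i \in oriented_edges H] &&
    [exists v : ((m + k).-1).-tuple T,
      [forall i : 'I_m, val (tnth w i) == take k (drop i v)]]].

Definition walks_between (T : finType) (k : nat) (H : kgraph T k) (m : nat)
    (e f : k.-tuple T) : {set m.-tuple (k.-tuple T)} :=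
  [set w in walks H m | (onth w 0 == Some e) && (onth w m.-1 == Some f)].

Definition walk_connected (R : realType) (T : finType) (k : nat)
    (H : kgraph T k) (a : R) (m : nat) : Prop :=
  forall e f : k.-tuple T,
    e \in oriented_edges H -> f \in oriented_edges H ->
    a * #|vertices H|%:R ^+ m.-1 / #|oriented_edges H|%:R
      <= #|walks_between H m e f|%:R.

(* Main.v *)
Require Import Defs.
From HB Require Import structures.
From mathcomp Require Import all_boot all_order all_algebra.
From mathcomp Require Import boolp reals sequences exp.
From mathcomp Require Import ring lra zify.

(* Walk at random on the oriented edges of H, from (v_1, ..., v_k) to a uniform
   (v_2, ..., v_{k+1}).  The step matrix P is doubly stochastic, and
   (alpha, l_0)-connectedness is a Doeblin condition for it, so P^j is uniform up
   to a relative error eps that is exponentially small in j alpha / l_0.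

   Let pi(C) be the product of 1 / d(x) over the (k-1)-sets x in which
   consecutive edges of C meet.  For a function y on E(H), give the cycle C the
   weight 2 e(H) pi(C) (mean(y) + sum_{e in C} y(e) - sum_x ybar(x)), where
   ybar(x) is the average of y over the edges containing x.  Read along a closed
   walk starting at e, the increments y(e_{i+1}) - ybar(x_i) have conditional mean
   zero in the first half of the walk; in the second half, reversing time makes
   their expectations telescope to y(e) - mean(y).  Hence the total weight of the
   cycles through e is y(e), up to the mixing error and to the O(1/n) contribution
   of the closed walks with repeated vertices.  So y |-> total weight is close to
   the identity in the sup norm, some y close to 1 has all totals equal to 1, and
   for y close to 1 the weight of C is (1 +- mu) 2 e(H) pi(C). *)

Set Implicit Arguments.
Unset Strict Implicit.
Unset Printing Implicit Defensive.

Import Order.TTheory GRing.Theory Num.Theory.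
Local Open Scope ring_scope.

(** * Doubly stochastic kernels *)

Section KernelPowers.
Variables (R : comNzRingType) (S : finType).
Implicit Types (P : S -> S -> R) (M : nat -> S -> S -> R).

Fixpoint kpow P n x y : R :=
  if n is m.+1 then \sum_z P x z * kpow P m z y else (x == y)%:R.

(** The factors vary with time so that a single step of the walk can be replaced by another
    kernel. *)
Fixpoint kprod M n x y : R :=
  if n is m.+1 then \sum_z M 0%N x z * kprod (fun i => M i.+1) m z y
  else (x == y)%:R.

Fixpoint path_weight M x s : R :=
  if s is z :: s' then M 0%N x z * path_weight (fun i => M i.+1) z s' else 1.

Lemma sum_kpow0 x (f : S -> R) : \sum_z (x == z)%:R * f z = f x.
Proof.
rewrite (bigD1 x) //= eqxx mul1r big1 ?addr0 // => z zx.
by rewrite eq_sym (negbTE zx) mul0r.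
Qed.

Lemma kpowD P m n x y : kpow P (m + n) x y = \sum_z kpow P m x z * kpow P n z y.
Proof.
elim: m x => [|m IH] x /=; first by rewrite sum_kpow0.
under eq_bigr do rewrite IH mulr_sumr.
rewrite exchange_big; apply: eq_bigr => z _.
by rewrite mulr_suml; apply: eq_bigr => w _; rewrite mulrA.
Qed.

Lemma eq_kprod M M' n x y :
  (forall i z w, (i < n)%N -> M i z w = M' i z w) -> kprod M n x y = kprod M' n x y.
Proof.
elim: n M M' x => [|n IH] M M' x H //=; apply: eq_bigr => z _.
by rewrite H //; congr (_ * _); apply: IH => i w w' ltin; apply: H.
Qed.

Lemma kprod_const P n x y : kprod (fun=> P) n x y = kpow P n x y.
Proof. by elim: n x => [|n IH] x //=; apply: eq_bigr => z _; rewrite IH. Qed.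

(** For [D := increment P f] and [x = y = o], this sums, over the closed walks of length [n] at [o],
    the probability of the walk times the increment of [f] at step [i]. *)
Definition insertion P D i n x y : R :=
  \sum_z \sum_w kpow P i x z * D z w * kpow P (n - i.+1) w y.

Lemma kprod_insert P D i n x y : (i < n)%N ->
  kprod (fun j => if j == i then D else P) n x y = insertion P D i n x y.
Proof.
rewrite /insertion.
elim: i n x => [|i IH] [|n] x //= ltin.
  under [RHS]eq_bigr => z _ do
    (under eq_bigr => w _ do rewrite -mulrA; rewrite -mulr_sumr).
  rewrite sum_kpow0; apply: eq_bigr => w _.
  by rewrite subn1 -kprod_const; congr (_ * _); apply: eq_kprod.
under eq_bigr => z _ do rewrite (IH n z ltin) mulr_sumr.
rewrite exchange_big; apply: eq_bigr => w _ /=.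
under eq_bigr do rewrite mulr_sumr.
rewrite exchange_big; apply: eq_bigr => w' _ /=.
rewrite -mulrA mulr_suml subSS.
by apply: eq_bigr => z _; rewrite !mulrA.
Qed.

Lemma big_tuple_cons n (F : n.+1.-tuple S -> R) :
  \sum_t F t = \sum_x \sum_(t : n.-tuple S) F [tuple of x :: t].
Proof.
rewrite pair_big /= (reindex (fun p : S * n.-tuple S => [tuple of p.1 :: p.2])) //=.
exists (fun t : n.+1.-tuple S => (thead t, [tuple of behead t])) => [[x t] _|t _] /=.
  by rewrite theadE; congr (_, _); apply: val_inj.
by rewrite [RHS]tuple_eta; apply: val_inj.
Qed.

Lemma big_tuple_nil (F : 0.-tuple S -> R) : \sum_t F t = F [tuple].
Proof. by rewrite (bigD1 [tuple]) //= big1 ?addr0 // => t; rewrite tuple0. Qed.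

Lemma sum_path_weight M n x y :
  \sum_(t : n.-tuple S) path_weight M x (rcons t y) = kprod M n.+1 x y.
Proof.
elim: n M x => [|n IH] M x.
  rewrite big_tuple_nil /= (bigD1 y) //= eqxx big1 ?addr0 // => z zx.
  by rewrite (negbTE zx) mulr0.
by rewrite big_tuple_cons; apply: eq_bigr => z _; rewrite -mulr_sumr IH.
Qed.

Lemma path_weightE M x s d :
  path_weight M x s = \prod_(i < size s) M i (nth d (x :: s) i) (nth d s i).
Proof.
elim: s M x => [|z s IH] M x /=; first by rewrite big_ord0.
by rewrite big_ord_recl IH.
Qed.

End KernelPowers.

Section DoublyStochastic.
Variables (R : realFieldType) (S : finType) (P : S -> S -> R).
Hypothesis P_ge0 : forall x y, 0 <= P x y.
Hypothesis P_row : forall x, \sum_y P x y = 1.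
Hypothesis P_col : forall y, \sum_x P x y = 1.
Local Notation N := (#|S|%:R : R).

Lemma kpow_ge0 n x y : 0 <= kpow P n x y.
Proof.
elim: n x => [|n IH] x /=; first exact: ler0n.
by apply: sumr_ge0 => z _; rewrite mulr_ge0.
Qed.

Lemma kpow_row n x : \sum_y kpow P n x y = 1.
Proof.
elim: n x => [|n IH] x /=.
  by rewrite -[RHS](sum_kpow0 x (fun=> 1)); under [RHS]eq_bigr do rewrite mulr1.
rewrite exchange_big -[RHS](P_row x); apply: eq_bigr => z _.
by rewrite -mulr_sumr IH mulr1.
Qed.

Lemma kpow_col n y : \sum_x kpow P n x y = 1.
Proof.
elim: n y => [|n IH] y /=.
  under eq_bigr do rewrite eq_sym.
  by rewrite -[RHS](sum_kpow0 y (fun=> 1)); under [RHS]eq_bigr do rewrite mulr1.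
rewrite exchange_big -[RHS](IH y); apply: eq_bigr => z _.
by rewrite -mulr_suml P_col mul1r.
Qed.

Lemma card_gt0 (x : S) : 0 < N.
Proof. by rewrite ltr0n; apply/card_gt0P; exists x. Qed.

Lemma sum_const_card (c : R) : \sum_(x : S) c = N * c.
Proof. by rewrite sumr_const mulr_natl. Qed.

(** * Mixing under a Doeblin condition *)

Section Doeblin.
Variables (alpha c : R) (m k : nat).
Hypothesis minorization : forall x y, alpha / N <= kpow P m x y.
Hypothesis majorization : forall x y, kpow P k x y <= c / N.

Lemma kpow_osc_step (f : S -> R) (b B : R) j :
  (forall x, b <= f x <= b + B) ->
  forall x, b <= \sum_y kpow P j x y * f y <= b + B.
Proof.
move=> fP x; rewrite -{1}[b]mul1r -[b + B]mul1r -(kpow_row j x) !mulr_suml.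
by apply/andP; split; apply: ler_sum => y _; apply: ler_wpM2l;
   rewrite ?kpow_ge0 //; case/andP: (fP y).
Qed.

(** Every row of the [m]-step kernel contains the uniform part [alpha / N], which contributes the
    same constant for all [x]. The rest of each row has mass [1 - alpha], so the range of [f]
    shrinks by this factor. *)
Lemma kpow_osc_contract (f : S -> R) (b B : R) :
  (forall x, b <= f x <= b + B) ->
  exists b', forall x,
    b' <= \sum_y kpow P m x y * f y <= b' + (1 - alpha) * B.
Proof.
move=> fP.
exists (\sum_y alpha / N * f y + (1 - alpha) * b) => x.
have N0 := card_gt0 x.
have Er : \sum_y (kpow P m x y - alpha / N) = 1 - alpha.
  by rewrite sumrB kpow_row sum_const_card; congr (_ - _); field; rewrite gt_eqF.
have -> : \sum_y kpow P m x y * f y =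
    \sum_y alpha / N * f y + \sum_y (kpow P m x y - alpha / N) * f y.
  by rewrite -big_split; apply: eq_bigr => y _; rewrite /=; ring.
rewrite -addrA -mulrDr -Er !lerD2l !mulr_suml.
by apply/andP; split; apply: ler_sum => y _; apply: ler_wpM2l;
   rewrite ?subr_ge0 //; case/andP: (fP y).
Qed.

(** Fix the column [y]. After [k] steps its entries lie in [[0, c / N]], each further block of [m]
    steps contracts the interval by [1 - alpha], and surplus steps do not enlarge it. Since columns
    sum to 1, the value [1 / N] is the mean of the column and lies in the same interval. *)
Lemma kpow_mixing j t : (t * m + k <= j)%N ->
  forall x y, `|kpow P j x y - 1 / N| <= (1 - alpha) ^+ t * c / N.
Proof.
move=> lej x y; have N0 := card_gt0 x.
have [b hb] : exists b, forall x, b <= kpow P j x y <= b + (1 - alpha) ^+ t * c / N.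
  rewrite -(subnK lej); set r := (j - _)%N.
  have [b hb] : exists b, forall x,
      b <= kpow P (t * m + k) x y <= b + (1 - alpha) ^+ t * c / N.
    elim: t {lej r} => [|t [b hb]].
      by exists 0 => z; rewrite kpow_ge0 add0r expr0 mul1r majorization.
    have [b' hb'] := kpow_osc_contract hb; exists b' => z.
    have := hb' z; rewrite !exprS -!mulrA.
    by under eq_bigr do [];
       rewrite -kpowD addnA -mulSn.
  by exists b => z; rewrite kpowD; apply: kpow_osc_step.
have bN : b <= 1 / N <= b + (1 - alpha) ^+ t * c / N.
  rewrite ler_pdivlMr // ler_pdivrMr // ![_ * N]mulrC -!sum_const_card.
  by apply/andP; split; [rewrite -[leRHS](kpow_col j y)|rewrite -[leLHS](kpow_col j y)];
     apply: ler_sum => z _; case/andP: (hb z).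
case/andP: bN => b1 b2; case/andP: (hb x) => b3 b4.
rewrite ler_norml; apply/andP; split; lra.
Qed.

End Doeblin.

(** * Increments along closed walks *)

Section ClosedWalks.
Variables (f : S -> R) (B eps : R) (h l : nat).
Hypothesis f_bound : forall x, `|f x| <= B.
Hypothesis f_reversible :
  forall z, \sum_x P x z * (\sum_w P x w * f w) = \sum_x P x z * f x.
Hypothesis mixing :
  forall j x y, (h <= j)%N -> `|kpow P j x y - 1 / N| <= eps / N.
Hypothesis lt2hl : (2 * h <= l)%N.

Definition pmean x := \sum_w P x w * f w.
Definition increment x y := P x y * (f y - pmean x).
Definition mean := (\sum_x f x) / N.

Lemma pmean_bound x : `|pmean x| <= B.
Proof.
apply: le_trans (ler_norm_sum _ _ _) _.
rewrite -[B]mul1r -(P_row x) mulr_suml; apply: ler_sum => w _.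
by rewrite normrM ger0_norm ?P_ge0 // ler_wpM2l.
Qed.

Lemma increment_row x : \sum_y increment x y = 0.
Proof.
rewrite /increment; under eq_bigr do rewrite mulrBr.
by rewrite sumrB -mulr_suml P_row mul1r subrr.
Qed.

Lemma increment_bound x y : `|increment x y| <= P x y * (2 * B).
Proof.
rewrite normrM ger0_norm ?P_ge0 // ler_wpM2l ?P_ge0 //.
rewrite (le_trans (ler_normB _ _)) //.
have := f_bound y; have := pmean_bound x; lra.
Qed.

Lemma mean_bound (o : S) : `|mean| <= B.
Proof.
have N0 := card_gt0 o.
rewrite normrM normfV (gtr0_norm N0) ler_pdivrMr // [B * _]mulrC -sum_const_card.
by rewrite (le_trans (ler_norm_sum _ _ _)) //; apply: ler_sum => x _.
Qed.

(** Rows of [increment] sum to zero, so [1 / N] may be subtracted from the factor after the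
    insertion. That factor has [l - i.+1 >= h] steps, hence is mixed. *)
Lemma early_insertion i o : (i < h)%N ->
  `|insertion P increment i l o o| <= 2 * B * eps / N.
Proof.
move=> ltih; rewrite /insertion.
have -> : \sum_z \sum_w kpow P i o z * increment z w * kpow P (l - i.+1) w o =
  \sum_z kpow P i o z * \sum_w increment z w * (kpow P (l - i.+1) w o - 1 / N).
  apply: eq_bigr => z _.
  under eq_bigr do rewrite -mulrA.
  rewrite -mulr_sumr; congr (_ * _).
  under [RHS]eq_bigr do rewrite mulrBr.
  by rewrite sumrB -mulr_suml increment_row mul0r subr0.
rewrite (le_trans (ler_norm_sum _ _ _)) //.
rewrite -[leRHS]mul1r -[X in _ <= X * _](kpow_row i o) mulr_suml; apply: ler_sum => z _.
rewrite normrM (ger0_norm (kpow_ge0 _ _ _)) ler_wpM2l ?kpow_ge0 //.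
rewrite (le_trans (ler_norm_sum _ _ _)) //.
rewrite -[leRHS]mul1r -[X in _ <= X * _](P_row z) mulr_suml; apply: ler_sum => w _.
have -> : P z w * (2 * B * eps / N) = P z w * (2 * B) * (eps / N) by ring.
by rewrite normrM ler_pM // ?increment_bound //; apply: mixing; lia.
Qed.

(** Columns of [P] sum to 1, so this is the expectation of [f] after [j] steps of the time-reversed
    walk from [o]. *)
Definition past_mean j o := \sum_x f x * kpow P j x o.

(** Now the factor before the insertion is mixed and may be replaced by [1 / N]. The column sum of
    [increment] at [w] is [f w] minus the mean of [pmean] over the predecessors of [w]; by
    [f_reversible] the latter is the mean of [f] over them, which gives a difference of two
    consecutive past means. *)
Lemma late_insertion i o : (h <= i)%N -> (i < l)%N ->
  `|insertion P increment i l o o -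
    (past_mean (l - i.+1) o - past_mean (l - i) o) / N| <= 2 * B * eps / N.
Proof.
move=> lehi ltil; rewrite /insertion.
set j := (l - i.+1)%N; have -> : (l - i = j.+1)%N by rewrite /j; lia.
have E : past_mean j o - past_mean j.+1 o =
    \sum_w (\sum_z increment z w) * kpow P j w o.
  rewrite /increment.
  under eq_bigr => w _.
    under eq_bigr do rewrite mulrBr.
    rewrite sumrB -mulr_suml P_col mul1r f_reversible mulrBl; over.
  rewrite sumrB; congr (_ - _).
  under [RHS]eq_bigr do rewrite mulr_suml.
  rewrite exchange_big; apply: eq_bigr => x _ /=.
  by rewrite mulr_sumr; apply: eq_bigr => z _; ring.
have -> : \sum_z \sum_w kpow P i o z * increment z w * kpow P j w o -
    (past_mean j o - past_mean j.+1 o) / N =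
  \sum_w (\sum_z (kpow P i o z - 1 / N) * increment z w) * kpow P j w o.
  rewrite E exchange_big mulr_suml -sumrB; apply: eq_bigr => w _ /=.
  rewrite -mulr_suml; under [in RHS]eq_bigr do rewrite mulrBl.
  rewrite sumrB mulrBl -mulr_sumr; congr (_ - _); field.
  by rewrite gt_eqF ?(card_gt0 o).
rewrite (le_trans (ler_norm_sum _ _ _)) //.
rewrite -[leRHS]mulr1 -[X in _ <= _ * X](kpow_col j o) mulr_sumr; apply: ler_sum => w _.
rewrite normrM (ger0_norm (kpow_ge0 _ _ _)) ler_wpM2r ?kpow_ge0 //.
rewrite (le_trans (ler_norm_sum _ _ _)) //.
rewrite -[leRHS]mul1r -[X in _ <= X * _](P_col w) mulr_suml; apply: ler_sum => z _.
have -> : P z w * (2 * B * eps / N) = (eps / N) * (P z w * (2 * B)) by ring.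
by rewrite normrM ler_pM // ?increment_bound //; apply: mixing; lia.
Qed.

(** The late insertions telescope to [(f o - past_mean (l - h) o) / N]. This past mean is close to
    [mean], and the term [mean * kpow P l o o], close to [mean / N], cancels it. Each of the [l]
    insertions costs [2 * B * eps / N], and each of the two last approximations [eps * B / N]. *)
Lemma closed_walk_estimate o :
  `|mean * kpow P l o o + \sum_(i < l) insertion P increment i l o o - f o / N|
     <= (2 * l%:R + 2) * eps * B / N.
Proof.
have N0 := card_gt0 o.
have B0 : 0 <= B by apply: le_trans (f_bound o).
(* The main term of the insertion at step [i]. *)
pose G i := if (i < h)%N then 0 else
   (past_mean (l - i.+1) o - past_mean (l - i) o) / N.
have lehl : (h <= l)%N by lia.
have EG : \sum_(i < l) G i = (f o - past_mean (l - h) o) / N.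
  rewrite -(big_mkord xpredT G) (big_cat_nat (n := h)) //=.
  rewrite big_nat_cond big1 ?add0r; last first.
    by move=> i; rewrite andbT => /andP[_ ih]; rewrite /G ih.
  rewrite big_nat_cond (eq_bigr (fun i => (past_mean (l - i.+1) o - past_mean (l - i) o) / N)); last first.
    by move=> i; rewrite andbT => /andP[hi _]; rewrite /G ltnNge hi.
  rewrite -big_nat_cond -mulr_suml.
  rewrite (telescope_sumr (fun i => past_mean (l - i) o)) // subnn.
  congr ((_ - _) / _); rewrite /past_mean.
  rewrite -[RHS](sum_kpow0 o f); apply: eq_bigr => x _.
  by rewrite /= eq_sym mulrC.
have Hins : `|\sum_(i < l) (insertion P increment i l o o - G i)| <=
    l%:R * (2 * B * eps / N).
  rewrite (le_trans (ler_norm_sum _ _ _)) //.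
  rewrite mulr_natl -[in leRHS](card_ord l) -sumr_const; apply: ler_sum => i _.
  rewrite /G; case: ltnP => hi; first by rewrite subr0 early_insertion.
  exact: late_insertion.
have Hpast : `|past_mean (l - h) o - mean| <= eps * B.
  rewrite /past_mean /mean mulr_suml -sumrB (le_trans (ler_norm_sum _ _ _)) //.
  have -> : eps * B = \sum_(x : S) (B * (eps / N)).
    by rewrite sum_const_card; field; rewrite gt_eqF.
  apply: ler_sum => x _; rewrite -mulrBr normrM ler_pM //.
  by rewrite -[X in _ - X]mul1r; apply: mixing; lia.
have Hmean : `|mean * (kpow P l o o - 1 / N)| <= B * (eps / N).
  by rewrite normrM ler_pM ?mean_bound // mixing.
have -> : mean * kpow P l o o + \sum_(i < l) insertion P increment i l o o - f o / N
  = mean * (kpow P l o o - 1 / N) + \sum_(i < l) (insertion P increment i l o o - G i)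
    - (past_mean (l - h) o - mean) / N.
  by rewrite sumrB EG; field; rewrite gt_eqF.
have -> : (2 * l%:R + 2) * eps * B / N =
  B * (eps / N) + l%:R * (2 * B * eps / N) + (eps * B) / N.
  by field; rewrite gt_eqF.
rewrite (le_trans (ler_normB _ _)) // lerD //.
  by rewrite (le_trans (ler_normD _ _)) // lerD.
by rewrite normrM normfV (gtr0_norm N0) ler_pM2r ?invr_gt0.
Qed.

End ClosedWalks.
End DoublyStochastic.

(** * Cyclic arcs *)

Section CyclicArcs.
Variables (p k : nat).
Local Notation l := p.+1.
Hypotheses (k_ge2 : (2 <= k)%N) (le_2k_l : (2 * k <= l)%N).
Implicit Types a b c i j x : 'I_l.

Definition arc i : {set 'I_l} := [set iter j (@ordS l) i | j : 'I_k].

(** Splitting by wrap-around turns arithmetic modulo [l] into goals for [lia]; [ord_lia] automates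
    this. *)
Lemma val_addZp a b :
  ((a + b < l /\ (a + b)%R = a + b :> nat) \/ (l <= a + b /\ (a + b)%R = a + b - l :> nat))%N.
Proof.
rewrite /=; case: ltnP => h; first by left; rewrite modn_small.
right; split=> //; have [ha hb] := (ltn_ord a, ltn_ord b).
by rewrite -{1}(subnK h) modnDr modn_small; lia.
Qed.

Lemma val_subZp a b :
  ((b <= a /\ (a - b)%R = a - b :> nat) \/ (a < b /\ (a - b)%R = a + l - b :> nat))%N.
Proof.
have := val_addZp a (- b); have [ha hb] := (ltn_ord a, ltn_ord b).
have -> : (- b)%R = (if b == 0%N :> nat then 0 else l - b)%N :> nat.
  by case: eqP => /= [->|b0]; rewrite ?subn0 ?modnn // modn_small //; lia.
by case: eqP; lia.
Qed.

Ltac ord_lia := repeat match goal with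
  | |- context [nat_of_ord (?a - ?b)%R] =>
    move: (ltn_ord a) (ltn_ord b); case: (val_subZp a b) => [[+ ->]|[+ ->]]
  | |- context [nat_of_ord (?a + ?b)%R] =>
    move: (ltn_ord a) (ltn_ord b); case: (val_addZp a b) => [[+ ->]|[+ ->]]
  end; lia.

Lemma val_inZp m : (m < l)%N -> (inZp m : 'I_l) = m :> nat.
Proof. exact: modn_small. Qed.

Lemma iter_ordS m i : iter m (@ordS l) i = i + inZp m.
Proof.
elim: m => [|m IH] /=; first by apply/val_inj; rewrite /= mod0n addn0 modn_small.
apply/val_inj; rewrite IH /= -[(_ %% l).+1]addn1 modnDml -addnA [(_ %% l + 1)%N]addnC.
by rewrite [(i + (1 + _))%N]addnA !modnDmr -addnA add1n.
Qed.

Lemma mem_arc i x : (x \in arc i) = ((x - i)%R < k)%N.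
Proof.
apply/imsetP/idP => [[j _ ->]|h].
  rewrite iter_ordS addrAC subrr add0r val_inZp //.
  by have := ltn_ord j; lia.
by exists (Ordinal h); rewrite // iter_ordS [inZp _](valZpK (x - i)) addrC subrK.
Qed.

Lemma card_arc i : #|arc i| = k.
Proof.
rewrite card_imset ?card_ord // => a b; rewrite !iter_ordS => /addrI /(congr1 (@nat_of_ord _)).
have [ha hb] := (ltn_ord a, ltn_ord b).
by rewrite !val_inZp; try lia; move=> ?; apply/val_inj.
Qed.

Lemma arc_start i : i \in arc i.
Proof. by rewrite mem_arc subrr /=; lia. Qed.

Lemma arc_inj : injective arc.
Proof.
move=> a b E; apply/val_inj; rewrite /=; have := arc_start a; have := arc_start b.
by rewrite -{1}E {2}E !mem_arc; ord_lia.
Qed.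

Local Notation one := (inZp 1 : 'I_l).

Lemma val1 : one = 1%N :> nat.
Proof. by rewrite val_inZp //; lia. Qed.

Lemma arc_next i x : x \in arc i -> x != i -> x \in arc (i + one).
Proof.
rewrite !mem_arc => + xi; have v1 := val1.
have : nat_of_ord x <> nat_of_ord i by move=> /val_inj /eqP; apply/negP.
by ord_lia.
Qed.

(** If [b] is neither [a], [a + 1] nor [a - 1], then two points of [arc a] lie outside [arc b]: the
    first two when [b - a <= l - k], and the last two otherwise. Only one point, [c], may be
    missing. *)
Lemma arc_neighbour a b c :
  a != b -> (forall x, x \in arc a -> x != c -> x \in arc b) ->
  (b = a + one /\ c = a) \/ (b = a - one /\ c = a + inZp k.-1).
Proof.
move=> ab H; have v1 := val1.
have vk : (inZp k.-1 : 'I_l) = k.-1 :> nat by rewrite val_inZp //; lia.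
have vk2 : (inZp k.-2 : 'I_l) = k.-2 :> nat by rewrite val_inZp //; lia.
have nab : nat_of_ord a <> b by move=> /val_inj /eqP; apply/negP.
have out x : x \in arc a -> x \notin arc b -> x = c.
  by move=> xa; apply: contraNeq => xc; apply: H.
have [b1|nb1] := eqVneq b (a + one).
  left; split=> //; apply/esym/out; first exact: arc_start.
  by rewrite b1 mem_arc; ord_lia.
have [b2|nb2] := eqVneq b (a - one).
  by right; split=> //; apply/esym/out; rewrite ?b2 mem_arc; ord_lia.
have {}nb1 : nat_of_ord b <> a.+1 /\ ~ (a.+1 = l /\ b = 0%N :> nat).
  have : nat_of_ord b <> (a + one)%R by move=> /val_inj /eqP; apply/negP.
  by move: (ltn_ord b); ord_lia.
have {}nb2 : b.+1 <> a /\ ~ (a = 0%N :> nat /\ b.+1 = l).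
  have : nat_of_ord b <> (a - one)%R by move=> /val_inj /eqP; apply/negP.
  by move: (ltn_ord b); ord_lia.
exfalso; have [hd|hd] := leqP (b - a)%R (l - k).
  have A1 : a = c.
    by apply: out; rewrite ?arc_start // mem_arc; move: hd nb1 nb2; ord_lia.
  have A2 : a + one = c by apply: out; rewrite mem_arc; move: hd nb1 nb2; ord_lia.
  by move: A2; rewrite -A1 => /(congr1 (@nat_of_ord _)); ord_lia.
have A1 : a + inZp k.-1 = c by apply: out; rewrite mem_arc; move: hd nb1 nb2; ord_lia.
have A2 : a + inZp k.-2 = c by apply: out; rewrite mem_arc; move: hd nb1 nb2; ord_lia.
by move: A2; rewrite -A1 => /addrI /(congr1 (@nat_of_ord _)); rewrite vk vk2; lia.
Qed.

(** The flag [true] encodes a reflection, [false] a rotation. *)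
Definition dihedral (d : 'I_l * bool) i := if d.2 then d.1 - i else d.1 + i.

(** Consecutive arcs differ in one point at each end, so by [arc_neighbour] their images start at
    neighbouring positions, and the direction of the move tells which end of [arc (t i)] is [s i].
    Injectivity of [t] forbids a change of direction, so [s] is a rotation or a reflection. *)
Lemma arc_automorphism (s t : 'I_l -> 'I_l) :
  injective s -> (forall i, s @: arc i = arc (t i)) ->
  exists d, s =1 dihedral d.
Proof.
move=> s_inj st.
have t_inj : injective t.
  by move=> i j tij; apply/arc_inj/(imset_inj s_inj); rewrite !st tij.
have val2 : (one + one : 'I_l) = 2%N :> nat.
  by have v1 := val1; ord_lia.
have next i : (t (i + one) = t i + one /\ s i = t i) \/
              (t (i + one) = t i - one /\ s i = t i + inZp k.-1).
  apply: arc_neighbour.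
    apply/eqP => /t_inj/esym/eqP; rewrite -[X in _ == X]addr0 (inj_eq (addrI i)).
    by move/eqP/(congr1 (@nat_of_ord _)); rewrite val1.
  move=> x; rewrite -!st => /imsetP[y yi ->{x}] sy.
  apply: imset_f; apply: arc_next => //.
  by apply: contraNneq sy => ->.
have turn i : t (i + one + one) <> t i.
  move/t_inj/eqP; rewrite -addrA -[X in _ == X]addr0 (inj_eq (addrI i)).
  by move/eqP/(congr1 (@nat_of_ord _)); rewrite val2.
have inZpS m : inZp m.+1 = inZp m + one :> 'I_l.
  by apply/val_inj; rewrite /= modnDm addn1.
have allZ (Q : 'I_l -> Prop) : (forall m, Q (inZp m)) -> forall i, Q i.
  by move=> H i; rewrite -(valZpK i).
have [[t1 s0]|[t1 s0]] := next 0.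
  exists (t 0, false); suff H m : t (inZp m) = t 0 + inZp m /\ s (inZp m) = t (inZp m) /\
      t (inZp m + one) = t (inZp m) + one.
    by apply: allZ => m; rewrite /dihedral /=; have [<- [-> _]] := H m.
  elim: m => [|m [IH1 [IH2 IH3]]].
    have -> : inZp 0 = 0 :> 'I_l by apply/val_inj; rewrite /= mod0n.
    by rewrite addr0.
  rewrite inZpS IH3 IH1 addrA; split=> //.
  have [[h1 h2]|[h1 h2]] := next (inZp m + one); last first.
    by case: (turn (inZp m)); rewrite h1 IH3 addrK.
  by rewrite h1 h2 IH3 IH1.
exists (s 0, true); suff H m : t (inZp m) = t 0 - inZp m /\ s (inZp m) = t (inZp m) + inZp k.-1 /\
      t (inZp m + one) = t (inZp m) - one.
  by apply: allZ => m; rewrite /dihedral /= s0; have [h1 [-> _]] := H m; rewrite h1 addrAC.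
elim: m => [|m [IH1 [IH2 IH3]]].
  have -> : inZp 0 = 0 :> 'I_l by apply/val_inj; rewrite /= mod0n.
  by rewrite subr0.
rewrite inZpS IH3 IH1 opprD addrA; split=> //.
have [[h1 h2]|[h1 h2]] := next (inZp m + one).
  by case: (turn (inZp m)); rewrite h1 IH3 subrK.
by rewrite h1 h2 IH3 IH1.
Qed.

Lemma dihedral_inj d : injective (dihedral d).
Proof. by case: d => c [] a b; rewrite /dihedral /= => /addrI // /oppr_inj. Qed.

(** A reflection turns the last point of an arc into the first point of its image, hence the shift
    by [k.-1]. *)
Definition dihedral_arc (d : 'I_l * bool) i := if d.2 then d.1 - i - inZp k.-1 else d.1 + i.

Lemma dihedral_arcE d i : dihedral d @: arc i = arc (dihedral_arc d i).
Proof.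
have vk : (inZp k.-1 : 'I_l) = k.-1 :> nat by rewrite val_inZp //; lia.
apply/eqP; rewrite eqEcard (card_imset _ (@dihedral_inj d)) !card_arc leqnn andbT.
apply/subsetP => x /imsetP[y]; rewrite mem_arc => yi ->{x}.
rewrite mem_arc; case: d => c [].
  have -> : dihedral (c, true) y - dihedral_arc (c, true) i = inZp k.-1 - (y - i).
    change (c - y - (c - i - inZp k.-1) = inZp k.-1 - (y - i)).
    by rewrite !opprB addrCA; congr (_ + _); rewrite addrC addrA subrK.
  by move: yi; ord_lia.
have -> // : dihedral (c, false) y - dihedral_arc (c, false) i = y - i.
by change (c + y - (c + i) = y - i); rewrite opprD addrACA subrr add0r.
Qed.

Lemma dihedral_injective d d' : dihedral d =1 dihedral d' -> d = d'.
Proof.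
case: d d' => [c b] [c' b'] E.
have Ec : c = c'.
  by have := E 0; rewrite /dihedral /= !subr0 !addr0; case: b {E}; case: b'.
have := E one; rewrite -Ec /dihedral /=.
(* A rotation and a reflection with the same value at 0 differ at 1, because [l >= 4]. *)
have N2 : one <> - one.
  move/eqP; rewrite -addr_eq0 => /eqP/(congr1 (@nat_of_ord _)).
  have -> : (one + one : 'I_l) = 2%N :> nat by have v1 := val1; ord_lia.
  by [].
by case: b {E}; case: b' => // /addrI h; case: N2.
Qed.

End CyclicArcs.

(** * Tight cycles and their parametrizations *)

Section TightCycles.
Variables (T : finType) (p k : nat).
Local Notation l := p.+1.
Hypotheses (k_ge2 : (2 <= k)%N) (le_2k_l : (2 * k <= l)%N).
Implicit Types (H C : kgraph T k) (v : {ffun 'I_l -> T}) (i : 'I_l).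

Lemma edgeP H e : e \in edges H -> e \subset vertices H /\ #|e| = k.
Proof.
move=> eH; have := valP H; move/forallP/(_ e)/implyP/(_ eH)/andP => [? /eqP].
by [].
Qed.

Definition winset v i : {set T} := [set v (iter j (@ordS l) i) | j : 'I_k].

Lemma winsetE v i : winset v i = v @: arc k i.
Proof. by rewrite /arc -imset_comp; apply: eq_imset. Qed.

Lemma card_winset v i : injective v -> #|winset v i| = k.
Proof. by move=> vi; rewrite winsetE card_imset // card_arc. Qed.

Lemma winset_inj v : injective v -> injective (winset v).
Proof.
move=> vi i j; rewrite !winsetE => /(imset_inj vi).
exact: arc_inj.
Qed.

(** The test [#|e| == k] makes this a k-graph for every [v], injective or not, and matches the form
    of [tight_cycle]. *)
Definition cycle_pair v : {set T} * {set {set T}} :=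
  ([set v i | i : 'I_l],
   [set e : {set T} | (#|e| == k) && [exists i, e == winset v i]]).

Lemma cycle_pairP v :
  [forall e in (cycle_pair v).2, (e \subset (cycle_pair v).1) && (#|e| == k)].
Proof.
apply/forallP => e; apply/implyP; rewrite inE => /andP[-> /existsP[i /eqP ->]].
rewrite andbT; apply/subsetP => x /imsetP[j _ ->]; exact: imset_f.
Qed.

Definition cycle_of v : kgraph T k := KGraph (cycle_pairP v).

Lemma cycle_of_eq v C :
  (C == cycle_of v) = (vertices C == [set v i | i : 'I_l]) &&
   (edges C == [set e : {set T} | (#|e| == k) && [exists i, e == winset v i]]).
Proof. by rewrite -val_eqE /= /vertices /edges; case: (kgraph_val C). Qed.

Lemma edges_cycle_of v i : injective v -> winset v i \in edges (cycle_of v).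
Proof.
by move=> vi; rewrite inE card_winset // eqxx; apply/existsP; exists i.
Qed.

Lemma edges_cycle_ofP v e :
  injective v -> (e \in edges (cycle_of v)) = [exists i, e == winset v i].
Proof.
move=> vi; rewrite inE; case: existsP => [[i /eqP ->]|]; rewrite ?andbF //.
by rewrite card_winset // eqxx.
Qed.

Definition valid H v := injectiveb v && [forall i, winset v i \in edges H].

Lemma cycle_of_cycles H v :
  injectiveb v -> (cycle_of v \in cycles l H) = [forall i, winset v i \in edges H].
Proof.
move=> vi; have vinj := injectiveP _ vi.
have tc : tight_cycle l (cycle_of v).
  by apply/existsP; exists v; rewrite vi -cycle_of_eq eqxx.
rewrite inE tc andbT; apply/andP/forallP => [[_ /subsetP h] i|h].
  exact/h/edges_cycle_of.
split; apply/subsetP => x.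
  case/imsetP => i _ ->; have [/subsetP s _] := edgeP (h i).
  by apply: s; rewrite winsetE imset_f // arc_start.
by rewrite edges_cycle_ofP // => /existsP[i /eqP ->].
Qed.

Lemma cyclesP H C :
  C \in cycles l H -> exists2 v : {ffun 'I_l -> T}, injectiveb v & C = cycle_of v.
Proof.
rewrite inE => /andP[_ /existsP[v /and3P[vi hv he]]].
by exists v => //; apply/eqP; rewrite cycle_of_eq hv.
Qed.

(** Two parametrizations of one cycle differ by a permutation of the indices that maps arcs to arcs,
    that is, by one of the [2 * l] dihedral maps. *)
Lemma card_parametrizations v : injectiveb v ->
  #|[set v' : {ffun 'I_l -> T} | injectiveb v' && (cycle_of v' == cycle_of v)]| = (2 * l)%N.
Proof.
move=> /injectiveP vi.
pose F d := [ffun i => v (dihedral d i)].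
have F_inj : injective F.
  move=> d d' /ffunP E; apply: (dihedral_injective k_ge2 le_2k_l) => i.
  by have := E i; rewrite !ffunE => /vi.
have -> : (2 * l = #|F @: [set: 'I_l * bool]|)%N.
  by rewrite (card_imset _ F_inj) cardsT card_prod card_ord card_bool mulnC.
apply: eq_card => v'; rewrite inE; apply/andP/imsetP => [[/injectiveP v'i /eqP E]|[d _ ->]].
  have [E1 E2] : [set v' i | i : 'I_l] = [set v i | i : 'I_l] /\
       edges (cycle_of v') = edges (cycle_of v).
    by split; [have := congr1 (@vertices _ _) E | rewrite E].
  have ex i : exists j, v' i == v j.
    have : v' i \in [set v i | i : 'I_l] by rewrite -E1 imset_f.
    by case/imsetP => j _ ->; exists j.
  pose s i := xchoose (ex i).
  have sE i : v' i = v (s i) by apply/eqP/(xchooseP (ex i)).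
  have ext i : exists j, winset v' i == winset v j.
    by apply/existsP; rewrite -edges_cycle_ofP // -E2 edges_cycle_of.
  pose t i := xchoose (ext i).
  have tE i : winset v' i = winset v (t i) by apply/eqP/(xchooseP (ext i)).
  have [d dE] : exists d, s =1 dihedral d.
    apply: (@arc_automorphism p k k_ge2 le_2k_l s t).
      by move=> i j sij; apply: v'i; rewrite !sE sij.
    move=> i; apply: (imset_inj vi); rewrite -[RHS]winsetE -tE winsetE -[LHS]imset_comp.
    by apply: eq_imset => x; rewrite /= -sE.
  by exists d => //; apply/ffunP => i; rewrite ffunE sE dE.
have Fi : injective (F d).
  by move=> i j; rewrite !ffunE => /vi /dihedral_inj.
have FE i : winset (F d) i = winset v (dihedral_arc k d i).
  rewrite !winsetE -dihedral_arcE // -[RHS]imset_comp.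
  by apply: eq_imset => x /=; rewrite ffunE.
split; first exact/injectiveP.
have dsurj i : exists j, dihedral d j = i.
  have [g _ gK] := injF_bij (@dihedral_inj p d); by exists (g i).
have dasurj i : exists j, dihedral_arc k d j = i.
  have dai : injective (dihedral_arc k d).
    move=> a b; rewrite /dihedral_arc; case: d.2 => [/addIr|] /addrI //.
    exact: oppr_inj.
  have [g _ gK] := injF_bij dai; by exists (g i).
rewrite cycle_of_eq; apply/andP; split; apply/eqP/setP => x.
  apply/imsetP/imsetP => [[i _ ->]|[i _ ->]]; first by exists (dihedral d i); rewrite ?ffunE.
  by have [j <-] := dsurj i; exists j; rewrite ?ffunE.
rewrite !inE; congr (_ && _); apply/existsP/existsP => [[i]|[i]].
  by rewrite FE => h; exists (dihedral_arc k d i).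
by have [j <-] := dasurj i; rewrite -FE; exists j.
Qed.

Definition rotate_by (c : 'I_l) v : {ffun 'I_l -> T} := [ffun i => v (c + i)].

Lemma rotate_by0 v : rotate_by 0 v = v.
Proof. by apply/ffunP => i; rewrite ffunE add0r. Qed.

Lemma rotate_byD a b v : rotate_by a (rotate_by b v) = rotate_by (a + b) v.
Proof. by apply/ffunP => i; rewrite !ffunE addrA [b + a]addrC. Qed.

Lemma winset_rotate c v i : winset (rotate_by c v) i = winset v (c + i).
Proof.
rewrite /winset; apply: eq_imset => j; rewrite ffunE; congr (v _).
by rewrite !iter_ordS addrA.
Qed.

Lemma valid_rotate H c v : valid H (rotate_by c v) = valid H v.
Proof.
suff half c' v' : valid H v' -> valid H (rotate_by c' v').
  apply/idP/idP; last exact: half.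
  by move/(half (- c)); rewrite rotate_byD addNr rotate_by0.
case/andP => /injectiveP vi /forallP h; apply/andP; split.
  by apply/injectiveP => i j; rewrite !ffunE => /vi /addrI.
by apply/forallP => i; rewrite winset_rotate.
Qed.

(** Both sides count pairs of a valid [v] and an index [i] with [winset v i = e]. The windows of an
    injective [v] are distinct, so a cycle through [e] determines [i]; rotating by [i] moves the
    window to position 0, and there are [l] values of [i]. *)
Lemma sum_cycles (R : comNzRingType) H (W : {ffun 'I_l -> T} -> R) e :
  (forall c v, W (rotate_by c v) = W v) ->
  \sum_(C in cycles l H | e \in edges C)
     \sum_(v : {ffun 'I_l -> T} | injectiveb v && (cycle_of v == C)) W v =
  l%:R * \sum_(v | valid H v && (winset v 0 == e)) W v.
Proof.
move=> Wrot.
transitivity (\sum_(v | valid H v) \sum_(i | winset v i == e) W v).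
  rewrite (exchange_big_dep (valid H)) /=; last first.
    move=> C v /andP[Cl _] /andP[vi /eqP vC]; rewrite /valid vi.
    by rewrite -cycle_of_cycles // vC.
  apply: eq_bigr => v /andP[vi vH]; have vinj := injectiveP _ vi.
  case: (boolP [exists i, e == winset v i]) => he.
    rewrite (big_pred1 (cycle_of v)) => [|C] /=; last first.
      rewrite vi andTb eq_sym andbC; case: eqP => // ->.
      by rewrite cycle_of_cycles // vH edges_cycle_ofP // he.
    have [i /eqP ei] := existsP he.
    rewrite (big_pred1 i) => [//|j] /=.
    by rewrite ei (inj_eq (winset_inj vinj)).
  rewrite !big_pred0 // => [i|C] /=.
    by apply: contraNF he => /eqP <-; apply/existsP; exists i.
  apply/negP => /andP[/andP[_ eC] /andP[_ /eqP vC]]; case/negP: he.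
  by rewrite -edges_cycle_ofP // vC.
rewrite (exchange_big_dep predT) //=.
transitivity (\sum_(i : 'I_l) \sum_(v | valid H v && (winset v 0 == e)) W v); last first.
  by rewrite sumr_const card_ord mulr_natl.
apply: eq_bigr => i _.
rewrite (reindex (rotate_by (- i))) /=; last first.
  by exists (rotate_by i) => v _; rewrite rotate_byD ?addNr ?addrN rotate_by0.
apply: eq_big => v; last by rewrite Wrot.
by rewrite valid_rotate winset_rotate addNr.
Qed.

End TightCycles.

(** * The walk on oriented edges *)

Section EdgeWalk.
Variables (R : realFieldType) (T : finType) (k : nat) (H : kgraph T k).
Hypothesis k_gt0 : (0 < k)%N.

Definition oriented_edge := {t : k.-tuple T | t \in oriented_edges H}.
HB.instance Definition _ := Finite.on oriented_edge.
Implicit Types (x y z w : oriented_edge) (X : {set T}) (F : {set T} -> R).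

Definition support x : {set T} := [set a in val x].
Definition front x : seq T := take k.-1 (val x).
Definition back x : seq T := behead (val x).

Lemma support_edge x : support x \in edges H.
Proof. by have := valP x; rewrite inE. Qed.

Lemma oriented_uniq x : uniq (val x).
Proof.
have [_] := edgeP (support_edge x).
by rewrite /support cardsE => h; apply/card_uniqP; rewrite h size_tuple.
Qed.

Lemma oriented_vertex x a : a \in val x -> a \in vertices H.
Proof.
by have [/subsetP s _] := edgeP (support_edge x); move=> ax; apply: s; rewrite inE.
Qed.

Lemma size_front x : size (front x) = k.-1.
Proof. by rewrite size_take size_tuple; case: ltnP; lia. Qed.

Lemma size_back x : size (back x) = k.-1.
Proof. by rewrite size_behead size_tuple. Qed.

Lemma oriented_consE x d : tval (val x) = nth d (val x) 0 :: back x.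
Proof.
have := size_tuple (val x); rewrite /back.
by case: (tval (val x)) => //= ?; lia.
Qed.

Lemma oriented_rconsE x d : tval (val x) = rcons (front x) (nth d (val x) k.-1).
Proof.
by rewrite /front -take_nth ?size_tuple ?prednK // take_oversize // size_tuple.
Qed.

Lemma support_cons x d : support x = [set b in nth d (val x) 0 :: back x].
Proof.
apply/setP => b; rewrite !inE -[b \in val x]/(b \in tval (val x)).
by rewrite {1}(oriented_consE x d) inE.
Qed.

Lemma support_rcons x d : support x = [set b in nth d (val x) k.-1 :: front x].
Proof.
apply/setP => b; rewrite !inE -[b \in val x]/(b \in tval (val x)).
by rewrite {1}(oriented_rconsE x d) mem_rcons inE.
Qed.

(** An oriented edge with front [u] is determined by its last vertex. The edge [x] supplies the
    default values. *)
Lemma sum_front x u F : size u = k.-1 ->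
  \sum_(w | front w == u) F (support w) =
  \sum_(a | [set b in a :: u] \in edges H) F [set b in a :: u].
Proof.
move=> su; pose dflt := thead (tcast (esym (prednK k_gt0)) (val x)).
have sz a : size (rcons u a) == k by rewrite size_rcons su prednK.
pose h a : oriented_edge := insubd x (Tuple (sz a)).
pose h' w := nth dflt (val w) k.-1.
have hE a : [set b in a :: u] \in edges H -> tval (val (h a)) = rcons u a.
  move=> ha; rewrite /h insubdK // inE (_ : [set b in _] = [set b in a :: u]) //.
  by apply/setP => b; rewrite !inE mem_rcons inE.
have hK w : front w == u -> h (h' w) = w.
  move=> /eqP wu; apply/val_inj/val_inj; rewrite /= hE; last first.
    by rewrite -wu -(support_rcons w) support_edge.
  by rewrite (oriented_rconsE w dflt) wu.
rewrite (reindex_onto h h' hK); apply: eq_big => a.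
  apply/andP/idP => [[/eqP fu /eqP h'a]|ha].
    by rewrite -[X in X :: _]h'a -fu -(support_rcons (h a) dflt) support_edge.
  rewrite /front /h' hE // -su -{1}cats1 take_size_cat // nth_rcons ltnn.
  by rewrite !eqxx.
by move=> /andP[/eqP fu /eqP h'a]; rewrite (support_rcons _ dflt) fu -/(h' _) h'a.
Qed.

Lemma sum_back x u F : size u = k.-1 ->
  \sum_(w | back w == u) F (support w) =
  \sum_(a | [set b in a :: u] \in edges H) F [set b in a :: u].
Proof.
move=> su; pose dflt := thead (tcast (esym (prednK k_gt0)) (val x)).
have sz a : size (a :: u) == k by rewrite /= su prednK.
pose h a : oriented_edge := insubd x (Tuple (sz a)).
pose h' w := nth dflt (val w) 0.
have hE a : [set b in a :: u] \in edges H -> tval (val (h a)) = a :: u.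
  by move=> ha; rewrite /h insubdK // inE.
have hK w : back w == u -> h (h' w) = w.
  move=> /eqP wu; apply/val_inj/val_inj; rewrite /= hE; last first.
    by rewrite -wu -(support_cons w) support_edge.
  by rewrite (oriented_consE w dflt) wu.
rewrite (reindex_onto h h' hK); apply: eq_big => a.
  apply/andP/idP => [[/eqP fu /eqP h'a]|ha].
    by rewrite -[X in X :: _]h'a -fu -(support_cons (h a) dflt) support_edge.
  by rewrite /back /h' hE //= !eqxx.
by move=> /andP[/eqP fu /eqP h'a]; rewrite (support_cons _ dflt) fu -/(h' _) h'a.
Qed.

(** An edge containing [u] has exactly one further vertex. Conversely, a vertex completing [u] to an
    edge cannot lie in [u], since edges have [k] elements. *)
Lemma degreeE (u : seq T) : uniq u -> size u = k.-1 ->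
  degree H [set b in u] = #|[set a | [set b in a :: u] \in edges H]|.
Proof.
move=> uu su; set A := [set a | [set b in a :: u] \in edges H].
have consE a : [set b in a :: u] = a |: [set b in u].
  by apply/setP => b; rewrite !inE.
have AE a : (a \in A) = ([set b in a :: u] \in edges H) by rewrite /A in_set.
have out a : a \in A -> a \notin u.
  rewrite AE => /edgeP[_ ck]; apply/negP => au.
  have : [set b in a :: u] = [set b in u].
    by apply/setP => b; rewrite !inE; case: eqP => // ->; rewrite au.
  by move=> E; move: ck; rewrite E cardsE (card_uniqP uu) su; lia.
rewrite /degree -(card_in_imset (f := fun a => [set b in a :: u]) (D := A)).
  apply: eq_card => e; rewrite inE; apply/andP/imsetP => [[eH ue]|[a]].
    have [_ ek] := edgeP eH.
    have : #|e :\: [set b in u]| == 1%N.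
      rewrite cardsD (setIidPr ue) ek cardsE (card_uniqP uu) su; lia.
    case/cards1P => a ea; have ee : e = [set b in a :: u].
      rewrite -(setID e [set b in u]) (setIidPr ue) ea consE setUC; congr (_ :|: _).
    by exists a; rewrite // AE -ee.
  by rewrite AE => aA ->; split=> //; rewrite consE subsetUr.
move=> a a' aA a'A; rewrite !consE => /setP /(_ a); rewrite !inE eqxx /= => /esym.
by rewrite (negbTE (out a aA)) orbF => /eqP.
Qed.

Definition codegree (u : seq T) : R := (degree H [set b in u])%:R.

Definition link_mean F (u : seq T) : R :=
  (\sum_(a | [set b in a :: u] \in edges H) F [set b in a :: u]) / codegree u.

Definition adjacent x y := front y == back x.
Definition edge_walk x y : R := (adjacent x y)%:R / codegree (back x).

Lemma uniq_back x : uniq (back x).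
Proof. by have := oriented_uniq x; rewrite /back; case: (tval _) => //= a s /andP[]. Qed.

Lemma uniq_front x : uniq (front x).
Proof. exact/take_uniq/oriented_uniq. Qed.

Lemma codegree_back_gt0 x : 0 < codegree (back x).
Proof.
rewrite ltr0n; apply/card_gt0P; exists (support x); rewrite inE support_edge.
by apply/subsetP => b; rewrite !inE => /mem_behead.
Qed.

Lemma codegree_front_gt0 x : 0 < codegree (front x).
Proof.
rewrite ltr0n; apply/card_gt0P; exists (support x); rewrite inE support_edge.
by apply/subsetP => b; rewrite !inE => /mem_take.
Qed.

Lemma edge_walk_next x F : \sum_y edge_walk x y * F (support y) = link_mean F (back x).
Proof.
rewrite /link_mean -(@sum_front x) ?size_back // mulr_suml [RHS]big_mkcond.
by apply: eq_bigr => y _; rewrite /edge_walk /adjacent; case: ifP => _;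
   by rewrite ?mulr0n ?mulr1n ?mul0r // mul1r mulrC.
Qed.

Lemma edge_walk_prev y F : \sum_x edge_walk x y * F (support x) = link_mean F (front y).
Proof.
rewrite /link_mean -(@sum_back y) ?size_front // mulr_suml [RHS]big_mkcond.
apply: eq_bigr => x _; rewrite /edge_walk /adjacent eq_sym; case: eqP => [->|_];
  by rewrite ?mulr0n ?mulr1n ?mul0r // mul1r mulrC.
Qed.

Lemma link_mean1 u : 0 < codegree u -> uniq u -> size u = k.-1 -> link_mean (fun=> 1) u = 1.
Proof.
move=> u0 uu su; rewrite /link_mean sumr_const.
rewrite (_ : #|_| = degree H [set b in u]).
  by rewrite -/(codegree u) divff // gt_eqF.
by rewrite degreeE // cardsE.
Qed.

Lemma edge_walk_ge0 x y : 0 <= edge_walk x y.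
Proof. by rewrite divr_ge0 ?ler0n. Qed.

Lemma edge_walk_row x : \sum_y edge_walk x y = 1.
Proof.
rewrite -(link_mean1 (codegree_back_gt0 x) (uniq_back x) (size_back x)) -edge_walk_next.
by apply: eq_bigr => y _; rewrite mulr1.
Qed.

(** All predecessors of [y] have back [front y]; they are as many as its codegree, and each moves to
    [y] with probability one over this codegree. *)
Lemma edge_walk_col y : \sum_x edge_walk x y = 1.
Proof.
rewrite -(link_mean1 (codegree_front_gt0 y) (uniq_front y) (size_front y)) -edge_walk_prev.
by apply: eq_bigr => x _; rewrite mulr1.
Qed.

(** Every predecessor [x] of [y] satisfies [back x = front y]. Hence the mean of [F] over the
    successors of [x] and its mean over the predecessors of [y] are both the average over the edges
    containing this common set. *)
Lemma edge_walk_reversible F y :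
  \sum_x edge_walk x y * (\sum_w edge_walk x w * F (support w)) =
  \sum_x edge_walk x y * F (support x).
Proof.
transitivity (\sum_x edge_walk x y * link_mean F (front y)).
  apply: eq_bigr => x _; rewrite edge_walk_next /edge_walk /adjacent.
  by case: eqP => [->|_]; rewrite ?mulr0n ?mul0r.
by rewrite -mulr_suml edge_walk_col mul1r edge_walk_prev.
Qed.

End EdgeWalk.

(** * Consequences of connectedness for the walk *)

Section ConnectedWalk.
Variables (R : realType) (T : finType) (k : nat) (H : kgraph T k).
Hypothesis k_gt0 : (0 < k)%N.
Local Notation S := (oriented_edge H).
Local Notation P := (edge_walk R (H:=H)).
Local Notation n := #|vertices H|.
Implicit Types (x y z w : S).

(** Its powers count walks, so connectedness bounds them from below. *)
Definition adjacency x y : R := (adjacent x y)%:R.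

Lemma card_oriented_edge : #|{: S}| = #|oriented_edges H|.
Proof. by rewrite card_sig; apply: eq_card. Qed.

Lemma card_oriented_edge_le : (#|{: S}| <= n ^ k)%N.
Proof.
pose f x : {ffun 'I_k -> T} := [ffun i => tnth (val x) i].
have fi : injective f.
  move=> x y /ffunP E; apply/val_inj/eq_from_tnth => i.
  by have := E i; rewrite !ffunE.
rewrite -[X in (_ <= _ ^ X)%N](card_ord k) -card_ffun_on -cardsT -(card_imset _ fi).
apply: subset_leq_card; apply/subsetP => _ /imsetP[x _ ->].
by apply/ffun_onP => i; rewrite ffunE (oriented_vertex (x := x)) // mem_tnth.
Qed.

Lemma codegree_le_card (u : seq T) : uniq u -> size u = k.-1 -> codegree R H u <= n%:R.
Proof.
move=> uu su; rewrite /codegree degreeE // ler_nat; apply: subset_leq_card.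
apply/subsetP => a; rewrite inE => /edgeP[/subsetP s _].
by apply: s; rewrite !inE eqxx.
Qed.

Lemma adjacency_row x : \sum_y adjacency x y = codegree R H (back x).
Proof.
rewrite -[RHS]mul1r -(edge_walk_row R k_gt0 x) mulr_suml; apply: eq_bigr => y _.
by rewrite divfK // gt_eqF // codegree_back_gt0.
Qed.

(** Codegrees are at most [n], so each admissible step has probability at least [1 / n]. *)
Lemma kpow_adjacency_le m x y : kpow adjacency m x y <= n%:R ^+ m * kpow P m x y.
Proof.
elim: m x => [|m IH] x /=; first by rewrite expr0 mul1r.
rewrite exprS -mulrA !mulr_sumr; apply: ler_sum => z _.
have -> : n%:R * (n%:R ^+ m * (P x z * kpow P m z y)) =
  n%:R * P x z * (n%:R ^+ m * kpow P m z y) by ring.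
have c0 := codegree_back_gt0 R x.
apply: ler_pM => //; rewrite ?ler0n //.
  by apply: kpow_ge0 => *; rewrite ler0n.
rewrite /edge_walk /adjacency mulrA ler_pdivlMr // mulrC ler_wpM2r ?ler0n //.
by rewrite codegree_le_card ?uniq_back ?size_back.
Qed.

Lemma kpow_adjacency_row m x :
  \sum_y kpow adjacency m.+1 x y <= codegree R H (back x) * n%:R ^+ m.
Proof.
have n_row r z : \sum_y kpow adjacency r z y <= n%:R ^+ r.
  rewrite -[leRHS]mulr1 -[X in _ <= _ * X](kpow_row (edge_walk_row R k_gt0) r z) mulr_sumr.
  by apply: ler_sum => y _; apply: kpow_adjacency_le.
rewrite /= exchange_big -adjacency_row mulr_suml; apply: ler_sum => z _.
by rewrite -mulr_sumr ler_wpM2l ?ler0n.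
Qed.

(** A walk of length [m.+2] lists [m.+2] oriented edges and so makes [m.+1] steps. Its end edges are
    prescribed, so the interior edges determine it. *)
Lemma walks_between_le m x y :
  #|walks_between H m.+2 (val x) (val y)|%:R <= kpow adjacency m.+1 x y.
Proof.
pose f (w : m.+2.-tuple (k.-tuple T)) : m.-tuple (oriented_edge H) :=
  [tuple insubd x (nth (val x) w i.+1) | i < m].
pose good := [set t : m.-tuple (oriented_edge H) | path (@adjacent _ _ _) x (rcons t y)].
have kE : kpow adjacency m.+1 x y = #|good|%:R.
  rewrite -kprod_const -sum_path_weight -sum1_card natr_sum [RHS]big_mkcond.
  apply: eq_bigr => t _; rewrite inE.
  elim: (rcons t y) x {f good} => //= z s IH x'.
  by rewrite IH /adjacency; case: adjacent; rewrite ?mulr1n ?mulr0n ?mul0r ?mul1r.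
have W (w : m.+2.-tuple (k.-tuple T)) : w \in walks_between H m.+2 (val x) (val y) ->
  [/\ forall i, (i < m.+2)%N -> nth (val x) w i \in oriented_edges H,
      forall i, (i.+1 < m.+2)%N ->
        behead (nth (val x) w i) = take k.-1 (nth (val x) w i.+1),
      nth (val x) w 0 = val x & nth (val x) w m.+1 = val y].
  rewrite !inE => /andP[/andP[/forallP h1 /existsP[v /forallP h2]] /andP[/eqP h3 /eqP h4]].
  split=> [i im|i im||]; try exact: onth_nth.
    by have := h1 (Ordinal im); rewrite (tnth_nth (val x)).
  have := h2 (Ordinal im); have := h2 (Ordinal (ltnW im)).
  rewrite !(tnth_nth (val x)) /= => /eqP -> /eqP ->.
  rewrite take_takel ?leq_pred // -[i.+1]add1n -drop_drop drop1.
  by case: (drop i v) => [|b s]; case: (k) k_gt0.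
have fE (w : m.+2.-tuple (k.-tuple T)) : w \in walks_between H m.+2 (val x) (val y) ->
  forall i, (i < m.+2)%N -> nth x (x :: rcons (f w) y) i = insubd x (nth (val x) w i).
  move=> /W[_ _ w0 wm] [|i] im /=; first by rewrite w0 valKd.
  rewrite nth_rcons size_tuple card_ord; case: ltnP => im'.
    exact: (nth_mktuple _ x (Ordinal im')).
  have -> : i = m by lia.
  by rewrite eqxx wm valKd.
have valE (w : m.+2.-tuple (k.-tuple T)) : w \in walks_between H m.+2 (val x) (val y) ->
  forall i, (i < m.+2)%N -> val (nth x (x :: rcons (f w) y) i) = nth (val x) w i.
  by move=> hw i im; rewrite fE // insubdK //; have [h _ _ _] := W w hw; apply: h.
rewrite kE ler_nat -(card_in_imset (f := f)).
  apply: subset_leq_card; apply/subsetP => _ /imsetP[w hw ->].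
  rewrite inE; apply/(pathP x) => i; rewrite size_rcons size_tuple => im.
  rewrite -[nth x (rcons _ _) i]/(nth x (x :: rcons (f w) y) i.+1).
  rewrite /adjacent /front /back !valE //; last by lia.
  by have [_ h _ _] := W w hw; rewrite h.
move=> w w' hw hw' E; apply/val_inj/(@eq_from_nth _ (val x)); rewrite ?size_tuple // => i im.
by rewrite -!valE // E.
Qed.

Section Bounds.
Variables (alpha : R) (m : nat).
Hypotheses (alpha_gt0 : 0 < alpha) (alpha_lt1 : alpha < 1).
Hypothesis connected : walk_connected H alpha m.+2.
Local Notation N := (#|{: S}|%:R : R).

Lemma kpow_adjacency_ge x y : alpha * n%:R ^+ m.+1 / N <= kpow adjacency m.+1 x y.
Proof.
apply: le_trans (walks_between_le m x y).
by rewrite card_oriented_edge; apply: connected; apply: valP.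
Qed.

Lemma vertices_gt0 x : (0 < n)%N.
Proof.
apply/card_gt0P; exists (tnth (val x) (Ordinal k_gt0)).
exact/oriented_vertex/mem_tnth.
Qed.

(** Summed over all [y], connectedness yields at least [alpha * n ^ m.+1] walks from [x]. Their
    first step has [codegree (back x)] choices and each of the other [m] steps at most [n]. *)
Lemma codegree_ge x : alpha * n%:R <= codegree R H (back x).
Proof.
have n0 : 0 < n%:R :> R by rewrite ltr0n (vertices_gt0 x).
have N0 := card_gt0 R x.
rewrite -(ler_pM2r (exprn_gt0 m n0)) -mulrA -exprS.
apply: le_trans (kpow_adjacency_row m x).
apply: le_trans (ler_sum _ (fun y _ => kpow_adjacency_ge x y)).
by rewrite sum_const_card [N * _]mulrC divfK // gt_eqF.
Qed.

Lemma edge_walk_minorization x y : alpha / N <= kpow P m.+1 x y.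
Proof.
have n0 : 0 < n%:R :> R by rewrite ltr0n (vertices_gt0 x).
rewrite -(ler_pM2l (exprn_gt0 m.+1 n0)).
apply: le_trans (kpow_adjacency_le m.+1 x y).
apply: le_trans (kpow_adjacency_ge x y).
by rewrite mulrA [alpha * _]mulrC.
Qed.

Lemma edge_walk_le x y : P x y <= (adjacent x y)%:R / (alpha * n%:R).
Proof.
have n0 : 0 < n%:R :> R by rewrite ltr0n (vertices_gt0 x).
rewrite ler_wpM2l ?ler0n // lef_pV2 ?posrE ?codegree_ge ?codegree_back_gt0 //.
by rewrite mulr_gt0.
Qed.

(* A walk of at most k steps is determined by its end points. *)
Lemma kpow_edge_walk_le j x y : (j <= k)%N ->
  kpow P j x y <= (drop j (val x) == take (k - j) (val y))%:R / (alpha * n%:R) ^+ j.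
Proof.
have n0 : 0 < n%:R :> R by rewrite ltr0n (vertices_gt0 x).
elim: j x => [|j IH] x jk /=.
  by rewrite expr0 invr1 mulr1 drop0 subn0 take_oversize ?size_tuple.
(* The next state takes its first [k.-1] vertices from [x] and those from position [j] on from [y].
   As [j <= k.-1], at most one state qualifies. *)
pose cond z := (front z == back x) && (drop j (val z) == take (k - j) (val y)).
have cond0 z : ~~ cond z -> P x z * kpow P j z y = 0.
  rewrite negb_and /edge_walk /adjacent => /orP[/negbTE ->|h]; first by rewrite mulr0n !mul0r.
  apply/eqP; rewrite mulf_eq0; apply/orP; right.
  rewrite eq_le kpow_ge0 ?andbT; last by move=> *; apply: edge_walk_ge0.
  by apply: le_trans (IH z (ltnW jk)) _; rewrite (negbTE h) mulr0n mul0r.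
have [z0 cz0|none] := pickP cond; last first.
  rewrite big1 => [|z _]; first by rewrite divr_ge0 ?ler0n // exprn_ge0 // mulr_ge0 ?ltW.
  by rewrite cond0 ?none.
have /andP[/eqP zx /eqP zy] := cz0.
rewrite (bigD1 z0) //= big1 ?addr0; last first.
  move=> z zz0; rewrite cond0 //; apply: contra zz0 => /andP[/eqP zx' /eqP zy'].
  apply/eqP/val_inj/val_inj; rewrite /= -[LHS](cat_take_drop j) -[RHS](cat_take_drop j).
  rewrite zy zy'; congr (_ ++ _).
  rewrite -(@take_takel _ j k.-1); last by lia.
  rewrite -[RHS](@take_takel _ j k.-1); last by lia.
  by rewrite -!/(front _) zx zx'.
have -> : drop j.+1 (val x) == take (k - j.+1) (val y).
  rewrite -[j.+1]addn1 -drop_drop drop1 -/(back x) -zx /front.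
  have kE : k.-1 = (k - j.+1 + j)%N by lia.
  rewrite kE -take_drop zy take_takel //; last by lia.
  by rewrite addn1.
rewrite mulr1n mul1r exprS invfM ler_pM ?edge_walk_ge0 //.
- by apply: kpow_ge0 => *; apply: edge_walk_ge0.
- apply: le_trans (edge_walk_le x z0) _; by rewrite ler_piMl ?lern1 ?leq_b1 // ?invr_ge0 ?mulr_ge0 ?ltW //.
apply: le_trans (IH z0 (ltnW jk)) _.
by rewrite ler_piMl ?lern1 ?leq_b1 // ?invr_ge0 ?exprn_ge0 ?mulr_ge0 ?ltW //.
Qed.

(** At most one walk of [k] steps joins [x] to [y], with probability at most [(alpha * n) ^- k], and
    [N <= n ^ k]. *)
Lemma edge_walk_majorization x y : kpow P k x y <= alpha ^- k / N.
Proof.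
have n0 : 0 < n%:R :> R by rewrite ltr0n (vertices_gt0 x).
have N0 := card_gt0 R x.
apply: le_trans (kpow_edge_walk_le x y (leqnn k)) _.
apply: (@le_trans _ _ ((alpha * n%:R) ^- k)).
  by rewrite ler_piMl ?lern1 ?leq_b1 // ?invr_ge0 ?exprn_ge0 ?mulr_ge0 ?ltW.
rewrite exprMn invfM; apply: ler_wpM2l; first by rewrite invr_ge0 exprn_ge0 // ltW.
by rewrite lef_pV2 ?posrE ?exprn_gt0 // -natrX ler_nat card_oriented_edge_le.
Qed.

End Bounds.
End ConnectedWalk.

(** * Closed walks as vertex sequences *)

Section ClosedSequences.
Variables (R : realFieldType) (T : finType) (k p : nat) (H : kgraph T k).
Hypothesis k_gt0 : (0 < k)%N.
Local Notation l := p.+1.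
Local Notation S := (oriented_edge H).
Local Notation P := (edge_walk R (H:=H)).
Implicit Types (v : {ffun 'I_l -> T}) (i : 'I_l) (F : {set T} -> R).

Definition window v i : k.-tuple T := [tuple v (iter j (@ordS l) i) | j < k].

Lemma nth_window d v i j : (j < k)%N -> nth d (window v i) j = v (iter j (@ordS l) i).
Proof. by move=> jk; rewrite -[j]/(nat_of_ord (Ordinal jk)) -tnth_nth tnth_mktuple. Qed.

Lemma set_window v i : [set a in window v i] = winset k v i.
Proof.
apply/setP => a; rewrite inE; apply/idP/imsetP => [/tnthP[j ->]|[j _ ->]].
  by exists j; rewrite ?tnth_mktuple.
by rewrite -(tnth_mktuple (fun j : 'I_k => v (iter j (@ordS l) i)) j) mem_tnth.
Qed.

Lemma behead_window v i : behead (window v i) = take k.-1 (window v (ordS i)).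
Proof.
pose d := v i.
apply: (@eq_from_nth _ d) => [|j].
  by rewrite size_behead size_take !size_tuple; case: ltnP; lia.
rewrite size_behead size_tuple => jk.
rewrite nth_behead nth_take ?nth_window ?iterSr //; lia.
Qed.

Definition edge_mean F : R := mean (fun x : S => F (support x)).

Definition closed_weight v : R := \prod_i (codegree R H (behead (window v i)))^-1.

(** Pairing the edge at [ordS i] with the set shared by the edges at [i] and [ordS i] makes each
    summand the increment of one step of the walk. *)
Definition correction F v : R :=
  edge_mean F + \sum_i (F (winset k v (ordS i)) - link_mean H F (behead (window v i))).

Definition closed_sequence v := [forall i, winset k v i \in edges H].

Section FixedStart.
Variables (o : S) (F : {set T} -> R).
Local Notation f := (fun x : S => F (support x)).
Implicit Types (t : p.-tuple (oriented_edge H)).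

Definition cyclic_step t i : S := nth o (o :: t) i.

Lemma nth_cyclic_step t i : nth o (rcons t o) i = cyclic_step t (ordS i).
Proof.
rewrite /cyclic_step nth_rcons size_tuple /=; have := ltn_ord i.
rewrite ltnS leq_eqVlt => /orP[/eqP ->|ip].
  by rewrite ltnn eqxx modnn.
by rewrite ip modn_small // -nth_behead.
Qed.

Definition step_chain t := [forall i, adjacent (cyclic_step t i) (cyclic_step t (ordS i))].

(** Expand every kernel product over the closed walks at [o]. A sequence with a non-adjacent step
    has probability zero; on the others the steps contribute inverse codegrees, and inserting at
    step [i] multiplies by the increment there. *)
Lemma insertion_sum :
  edge_mean F * kpow P l o o + \sum_(i < l) insertion P (increment P f) i l o o =
  \sum_(t | step_chain t) (\prod_i (codegree R H (back (cyclic_step t i)))^-1) *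
    (edge_mean F + \sum_i (f (cyclic_step t (ordS i)) - link_mean H F (back (cyclic_step t i)))).
Proof.
have pwE M t : path_weight M o (rcons t o) =
    \prod_(i < l) M i (cyclic_step t i) (cyclic_step t (ordS i)) :> R.
  rewrite (path_weightE _ _ _ o) size_rcons size_tuple; apply: eq_bigr => i _.
  rewrite nth_cyclic_step; congr (M _ _ _); rewrite /cyclic_step.
  by rewrite -rcons_cons nth_rcons /= size_tuple ltn_ord.
have prodE (M : nat -> S -> S -> R) : kprod M l o o =
    \sum_t \prod_(i < l) M i (cyclic_step t i) (cyclic_step t (ordS i)).
  by rewrite -sum_path_weight; apply: eq_bigr => t _; rewrite pwE.
under eq_bigr => i _ do rewrite -kprod_insert // prodE.
rewrite -kprod_const prodE.
rewrite exchange_big mulr_sumr -big_split [RHS]big_mkcond; apply: eq_bigr => t _ /=.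
set Q := \prod_i _; transitivity (Q * (edge_mean F +
   \sum_i (f (cyclic_step t (ordS i)) - link_mean H F (back (cyclic_step t i))))).
  rewrite mulrDr mulrC mulr_sumr; congr (_ + _); apply: eq_bigr => i _.
  rewrite /Q (bigD1 i) //= eqxx [in RHS](bigD1 i) //= /increment /pmean edge_walk_next //.
  rewrite mulrAC; congr (_ * _ * _).
  by apply: eq_bigr => j ji; rewrite ifN.
case: ifP => tc.
  rewrite /Q; congr (_ * _); apply: eq_bigr => i _.
  by rewrite /edge_walk (forallP tc i) mulr1n mul1r.
have /existsP[i ti] : [exists i, ~~ adjacent (cyclic_step t i) (cyclic_step t (ordS i))].
  by rewrite -negb_forall -/(step_chain t) tc.
by rewrite /Q (bigD1 i) //= /edge_walk (negbTE ti) mulr0n !mul0r.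
Qed.

(** Closed vertex sequences whose window at 0 is [o] correspond to closed walks at [o]: [h] lists
    the remaining windows, [h'] takes the first vertex of each state. *)
Lemma closed_sequence_sum :
  \sum_(v | closed_sequence v && (window v 0 == val o)) closed_weight v * correction F v =
  edge_mean F * kpow P l o o + \sum_(i < l) insertion P (increment P f) i l o o.
Proof.
rewrite insertion_sum.
pose d := tnth (val o) (Ordinal k_gt0).
pose h v : p.-tuple (oriented_edge H) := [tuple insubd o (window v (lift ord0 i)) | i < p].
pose h' t : {ffun 'I_l -> T} := [ffun i => nth d (val (cyclic_step t i)) 0].
(* By adjacency, entry [j] of state [i] is the first entry of the state [j] steps later. *)
have h'E t : step_chain t -> forall i, window (h' t) i = val (cyclic_step t i).
  move=> /forallP tc i; apply: eq_from_tnth => j; rewrite tnth_mktuple (tnth_nth d).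
  rewrite ffunE; have := ltn_ord j; move: (nat_of_ord j) => {}j.
  elim: j i => [|j IH] i jk //.
  rewrite iterSr IH ?(ltnW jk) // -nth_behead.
  have /eqP := tc i; rewrite /back => <-.
  by rewrite /front nth_take //; lia.
have stepE v : closed_sequence v -> window v 0 = val o ->
    forall i, val (cyclic_step (h v) i) = window v i.
  move=> /forallP vc v0 i; rewrite /cyclic_step.
  case: (unliftP ord0 i) => [j ->|->] /=; last by rewrite -v0.
  by rewrite nth_mktuple insubdK // inE set_window.
have hK t : step_chain t -> h (h' t) = t.
  move=> tc; apply: eq_from_tnth => j; rewrite tnth_mktuple h'E // valKd.
  by rewrite /cyclic_step /= (tnth_nth o).
rewrite (reindex_onto h h' hK); apply: eq_big => v.
  apply/andP/andP => [[vc /eqP v0]|[tc /eqP h'h]].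
    have E := stepE v vc v0; split.
      by apply/forallP => i; rewrite /adjacent /front /back !E behead_window.
    by apply/eqP/ffunP => i; rewrite ffunE E nth_window.
  have E i : window v i = val (cyclic_step (h v) i) by rewrite -h'E // h'h.
  split; last by rewrite E.
  by apply/forallP => i; rewrite -set_window E support_edge.
move=> /andP[vc /eqP v0]; have E := stepE v vc v0.
rewrite /closed_weight /correction; congr (_ * (_ + _)).
  by apply: eq_bigr => i _; rewrite /back E.
by apply: eq_bigr => i _; rewrite /back !E /support E set_window.
Qed.

End FixedStart.
End ClosedSequences.

(** * Rotation invariance *)

Section Rotation.
Variables (R : realFieldType) (T : finType) (k p : nat) (H : kgraph T k).
Local Notation l := p.+1.
Implicit Types (v : {ffun 'I_l -> T}) (i c : 'I_l) (F : {set T} -> R).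

Lemma window_rotate c v i : window k (rotate_by c v) i = window k v (c + i).
Proof.
apply: eq_from_tnth => j; rewrite !tnth_mktuple ffunE; congr (v _).
by rewrite !iter_ordS addrA.
Qed.

Lemma closed_weight_rotate c v :
  closed_weight R H (rotate_by c v) = closed_weight R H v.
Proof.
rewrite /closed_weight [RHS](reindex_inj (addrI c)).
by apply: eq_bigr => i _; rewrite window_rotate.
Qed.

Lemma correction_rotate F c v : correction H F (rotate_by c v) = correction H F v.
Proof.
rewrite /correction; congr (_ + _); rewrite [RHS](reindex_inj (addrI c)).
apply: eq_bigr => i _; rewrite window_rotate winset_rotate.
by rewrite -[ordS (c + i)]/(iter 1 (@ordS l) (c + i)) iter_ordS -addrA -iter_ordS.
Qed.

End Rotation.

(** * Closed walks with repeated vertices *)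

Section NonInjective.
Variables (T : finType) (k p : nat) (H : kgraph T k).
Hypothesis k_gt0 : (0 < k)%N.
Local Notation l := p.+1.
Hypothesis lt_kl : (k < l)%N.
Local Notation n := #|vertices H|.
Implicit Types (v : {ffun 'I_l -> T}) (i j : 'I_l) (o : oriented_edge H).

Lemma closed_sequence_vertex v i : closed_sequence H v -> v i \in vertices H.
Proof.
move/forallP/(_ i)/edgeP => [/subsetP s _]; apply: s.
by apply/imsetP; exists (Ordinal k_gt0).
Qed.

Lemma window0_nth d v o : window k v 0 = val o ->
  forall i, (i < k)%N -> v i = nth d (val o) i.
Proof.
move=> <- i ik; rewrite nth_window //; congr (v _).
rewrite iter_ordS add0r; apply/val_inj => /=; by rewrite modn_small.
Qed.

(** Asking only for entries in [vertices H], not for windows in [edges H], leaves a set that embeds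
    in a product. *)
Definition collision o i j : {set {ffun 'I_l -> T}} :=
  [set v : {ffun 'I_l -> T} | [forall a, v a \in vertices H] && (window k v 0 == val o) && (v i == v j)].

(* v is determined by its values off [0, k) and j, because v j = v i. *)
Lemma card_collision o i j : i != j -> (k <= j)%N ->
  (#|collision o i j| <= n ^ (l - k.+1))%N.
Proof.
move=> ij kj; pose d := tnth (val o) (Ordinal k_gt0).
pose fixed (a : 'I_l) := (a < k)%N || (a == j).
pose val_fixed (a : 'I_l) := if a == j then d else nth d (val o) a.
pose D (a : 'I_l) : {pred T} := if fixed a then pred1 (val_fixed a) else mem (vertices H).
(* Overwriting entry [j] loses nothing, as [v j = v i] with [i != j], and puts the image into a
   product of singletons and copies of [vertices H]. *)
pose g v : {ffun 'I_l -> T} := [ffun a => if a == j then d else v a].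
have g_inj : {in collision o i j &, injective g}.
  move=> v w; rewrite !inE => /andP[_ /eqP vij] /andP[_ /eqP wij] /ffunP E.
  apply/ffunP => a; have := E a; rewrite !ffunE; case: eqP => // -> _.
  by have := E i; rewrite !ffunE (negbTE ij) -vij -wij.
rewrite -(card_in_imset g_inj).
apply: (@leq_trans #|family D|).
  apply: subset_leq_card; apply/subsetP => _ /imsetP[v vc ->].
  move: vc; rewrite inE => /andP[/andP[/forallP vH /eqP v0] _].
  apply/familyP => a; rewrite ffunE /D /fixed /val_fixed.
  have [->|aj] := eqVneq a j; first by rewrite orbT inE eqxx.
  rewrite orbF; case: ltnP => ak; last exact: vH.
  by rewrite inE (window0_nth d v0).
rewrite card_family foldrE big_map big_enum /=.
rewrite (eq_bigr (fun a => if a \in ~: (j |: [set b : 'I_l | (b < k)%N]) then n else 1%N)); last first.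
  by move=> a _; rewrite /D !inE orbC -/(fixed a); case: (fixed a); rewrite /= ?card1.
rewrite -big_mkcond /= prod_nat_const.
suff -> : #|~: (j |: [set b : 'I_l | (b < k)%N])| = (l - k.+1)%N by [].
rewrite cardsCs setCK card_ord cardsU1 inE -leqNgt kj.
suff -> : #|[set b : 'I_l | (b < k)%N]| = k by [].
have w_inj : injective (widen_ord (ltnW lt_kl)).
  by move=> a b /(congr1 (@nat_of_ord _)) /= /val_inj.
rewrite -[RHS](card_ord k) -cardsT -(card_imset _ w_inj); apply: eq_card => b.
rewrite inE; apply/idP/imsetP => [bk|[a _ ->]]; last by rewrite /= ltn_ord.
by exists (Ordinal bk) => //; apply/val_inj.
Qed.

(** The first [k] entries of [v] are those of [o] and hence distinct, so one of two indices with
    equal entries is at least [k]. *)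
Lemma noninjective_collision v o :
  closed_sequence H v -> window k v 0 = val o -> ~~ injectiveb v ->
  exists ij : 'I_l * 'I_l, [&& ij.1 != ij.2, (k <= ij.2)%N & v \in collision o ij.1 ij.2].
Proof.
move=> vc v0; pose d := tnth (val o) (Ordinal k_gt0).
move/injectivePn => [i [j ij vij]].
have inC a b : v a = v b -> v \in collision o a b.
  move=> vab; rewrite inE v0 vab !eqxx !andbT.
  by apply/forallP => c; apply: closed_sequence_vertex.
have [kj|jk] := leqP k j.
  by exists (i, j); rewrite ij kj inC.
have [ki|ik] := leqP k i.
  by exists (j, i); rewrite eq_sym ij ki inC.
exfalso; move: vij; rewrite !(window0_nth d v0) // => /eqP.
by rewrite nth_uniq ?size_tuple ?oriented_uniq // => /eqP/val_inj/eqP; apply/negP.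
Qed.

Lemma card_noninjective o :
  (#|[set v : {ffun 'I_l -> T} | closed_sequence H v && (window k v 0%R == val o) && ~~ injectiveb v]|
     <= l ^ 2 * n ^ (l - k.+1))%N.
Proof.
rewrite -sum1_card big_mkcond /=.
apply: (@leq_trans (\sum_(v : {ffun 'I_l -> T}) \sum_(ij : 'I_l * 'I_l | (ij.1 != ij.2) && (k <= ij.2)%N)
  (v \in collision o ij.1 ij.2))).
  apply: leq_sum => v _; rewrite inE; case: ifP => // /andP[/andP[vc /eqP v0] vi].
  have [ij /and3P[h1 h2 h3]] := noninjective_collision vc v0 vi.
  by rewrite (bigD1 ij) /= ?h1 ?h2 // h3 leq_addr.
rewrite exchange_big /=.
apply: (@leq_trans (\sum_(ij : 'I_l * 'I_l) n ^ (l - k.+1))).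
  rewrite big_mkcond /=; apply: leq_sum => ij _; case: ifP => // /andP[h1 h2].
  by rewrite -big_mkcond sum1_card card_collision.
by rewrite sum_nat_const card_prod card_ord.
Qed.

End NonInjective.

(** * Total weight of the cycles through an edge *)

Section CycleWeights.
Variables (R : realType) (T : finType) (k p : nat) (H : kgraph T k).
Local Notation l := p.+1.
Hypotheses (k_ge2 : (2 <= k)%N) (le_2k_l : (2 * k <= l)%N).
Local Notation S := (oriented_edge H).
Local Notation N := (#|{: S}|%:R : R).
Local Notation n := #|vertices H|.
Local Notation P := (edge_walk R (H:=H)).
Implicit Types (v : {ffun 'I_l -> T}) (F : {set T} -> R) (C : kgraph T k) (o : S).

Let k_gt0 : (0 < k)%N. Proof. by lia. Qed.

Lemma card_orientations e : e \in edges H -> #|[set o : oriented_edge H | support o == e]| = k`!.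
Proof.
move=> eH; have [_ ek] := edgeP eH.
have -> : (k`! = #|[set t : k.-tuple T | all (mem e) t & uniq t]|)%N.
  by rewrite card_uniq_tuples -ffactnn; congr (_ ^_ _).
rewrite -(card_imset _ (@val_inj _ _ S)); apply: eq_card => t; rewrite inE.
apply/imsetP/andP => [[o]|[te tu]].
  rewrite inE => /eqP <- ->; rewrite oriented_uniq; split=> //.
  by apply/allP => a ao; have : a \in support o by rewrite inE.
have tE : [set x in t] = e.
  apply/eqP; rewrite eqEcard ek cardsE (card_uniqP tu) size_tuple leqnn andbT.
  by apply/subsetP => a; rewrite inE => /(allP te).
have tS : t \in oriented_edges H by rewrite inE tE.
exists (exist (fun t => t \in oriented_edges H) t tS) => //; rewrite inE; exact/eqP.
Qed.

Lemma card_oriented_edges : #|{: S}| = (k`! * #|edges H|)%N.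
Proof.
rewrite -[LHS]sum1_card (partition_big (@support T k H) (fun e => e \in edges H)) /=; last first.
  by move=> o _; apply: support_edge.
rewrite (eq_bigr (fun=> k`!)); first by rewrite sum_nat_const mulnC.
by move=> e eH; rewrite sum1dep_card -(card_orientations eH) cardsE.
Qed.

(* The sum has 2 l terms, one for each parametrization of C. *)
Definition cycle_weight F C : R :=
  #|edges H|%:R / l%:R *
  \sum_(v : {ffun 'I_l -> T} | injectiveb v && (cycle_of k v == C))
    closed_weight R H v * correction H F v.

(** The factor [l] from [sum_cycles] cancels the one in [cycle_weight]; the sequences are then
    sorted by the orientation of [e] that they show at position 0. *)
Lemma cycle_weight_total F e : e \in edges H ->
  \sum_(C in cycles l H | e \in edges C) cycle_weight F C =
  #|edges H|%:R * \sum_(o : oriented_edge H | support o == e)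
    \sum_(v : {ffun 'I_l -> T} | closed_sequence H v && (window k v 0 == val o) && injectiveb v)
       closed_weight R H v * correction H F v.
Proof.
move=> eH; rewrite -mulr_sumr (sum_cycles k_ge2 le_2k_l); last first.
  by move=> c v; rewrite closed_weight_rotate correction_rotate.
rewrite mulrA divfK ?pnatr_eq0 //; congr (_ * _).
rewrite (exchange_big_dep (fun v => valid H v && (winset k v 0 == e))) /=; last first.
  move=> o v /eqP oe /andP[/andP[vc /eqP v0] vi]; rewrite /valid vi -/(closed_sequence H v) vc.
  by rewrite -set_window v0; apply/eqP.
apply: eq_bigr => v /andP[/andP[vi vc] /eqP v0].
have wE : window k v 0 \in oriented_edges H by rewrite inE set_window v0.
pose o0 : S := exist (fun t => t \in oriented_edges H) _ wE; rewrite (big_pred1 o0) // => o /=.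
rewrite -/(closed_sequence H v) in vc; rewrite vi vc andbT /=.
apply/andP/eqP => [[_ /eqP oE]|->]; first exact/val_inj/esym.
by rewrite /support set_window v0 eqxx.
Qed.

Section Estimate.
Variables (alpha eps : R) (m h : nat).
Hypotheses (alpha_gt0 : 0 < alpha) (alpha_lt1 : alpha < 1).
Hypothesis connected : walk_connected H alpha m.+2.
Hypothesis mixing : forall j x y, (h <= j)%N -> `|kpow P j x y - 1 / N| <= eps / N.
Hypothesis le_2h_l : (2 * h <= l)%N.

(** The first term is the mixing error of [closed_walk_estimate], the second the contribution of
    closed walks with repeated vertices. *)
Definition defect : R :=
  (2 * l%:R + 2) * eps + l%:R ^+ 2 * (2 * l%:R + 1) * alpha ^- l / n%:R.

Variables (F : {set T} -> R) (B : R).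
Hypothesis F_bound : forall e, e \in edges H -> `|F e| <= B.

Lemma link_mean_bound o : `|link_mean H F (back o)| <= B.
Proof.
rewrite -edge_walk_next //.
apply: (@pmean_bound _ _ _ (edge_walk_ge0 R (H:=H)) (edge_walk_row R k_gt0) (fun x => F (support x))).
by move=> x; apply/F_bound/support_edge.
Qed.

Lemma window_oriented v i : closed_sequence H v -> window k v i \in oriented_edges H.
Proof. by move=> /forallP vc; rewrite inE set_window. Qed.

Lemma correction_bound v : closed_sequence H v -> `|correction H F v| <= (2 * l%:R + 1) * B.
Proof.
move=> vc.
have o : S by exists (window k v 0); apply: window_oriented.
have mb : `|edge_mean H F| <= B.
  by apply: (@mean_bound _ _ _ _ _ o) => x; apply/F_bound/support_edge.
have -> : (2 * l%:R + 1) * B = B + \sum_(i < l) 2 * B.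
  by rewrite sumr_const card_ord -mulr_natl; ring.
rewrite /correction (le_trans (ler_normD _ _)) // lerD //.
rewrite (le_trans (ler_norm_sum _ _ _)) // ler_sum // => i _.
rewrite (le_trans (ler_normB _ _)) // mulrDl mul1r lerD //.
  by apply: F_bound; apply: (forallP vc).
exact: (link_mean_bound (exist (fun t => t \in oriented_edges H) _ (window_oriented i vc))).
Qed.

Lemma closed_weight_ge0 v : 0 <= closed_weight R H v.
Proof. by apply: prodr_ge0 => i _; rewrite invr_ge0 ler0n. Qed.

Lemma closed_weight_le v : closed_sequence H v -> closed_weight R H v <= (alpha * n%:R) ^- l.
Proof.
move=> vc; rewrite -exprVn -[X in _ <= _ ^+ X](card_ord l) -prodr_const.
apply: ler_prod => i _; rewrite invr_ge0 ler0n /=.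
pose o : S := exist (fun t => t \in oriented_edges H) _ (window_oriented i vc).
have n0 : 0 < n%:R :> R by rewrite ltr0n (vertices_gt0 k_gt0 o).
rewrite lef_pV2 ?posrE ?mulr_gt0 ?(codegree_back_gt0 R o) //.
exact: (codegree_ge k_gt0 connected o).
Qed.

(** There are at most [l ^ 2 * n ^ (l - k.+1)] such sequences, with weight at most
    [(alpha * n) ^- l] and correction at most [(2 * l + 1) * B]. The remaining power [n ^- k.+1] is
    at most [1 / (n * N)]. *)
Lemma noninjective_bound o :
  `|\sum_(v : {ffun 'I_l -> T} | closed_sequence H v && (window k v 0 == val o) && ~~ injectiveb v)
       closed_weight R H v * correction H F v| <=
  l%:R ^+ 2 * (2 * l%:R + 1) * alpha ^- l / n%:R * B / N.
Proof.
have n0 : 0 < n%:R :> R by rewrite ltr0n (vertices_gt0 k_gt0 o).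
have N0 : 0 < N by apply: card_gt0 o.
have B0 : 0 <= B by apply: le_trans (F_bound (support_edge o)).
have lk : (k < l)%N by lia.
have L0 : 0 <= 2 * l%:R + 1 :> R by rewrite addr_ge0 // mulr_ge0.
have q0 : 0 <= (alpha * n%:R) ^- l by rewrite invr_ge0 exprn_ge0 // mulr_ge0 // ltW.
apply: le_trans (ler_norm_sum _ _ _) _.
apply: (@le_trans _ _ (\sum_(v in [set v : {ffun 'I_l -> T} |
   closed_sequence H v && (window k v 0 == val o) && ~~ injectiveb v])
     (alpha * n%:R) ^- l * ((2 * l%:R + 1) * B))).
  rewrite big_set; apply: ler_sum => v /andP[/andP[vc _] _].
  rewrite normrM ger0_norm ?closed_weight_ge0 // ler_pM ?closed_weight_ge0 //.
    exact: closed_weight_le.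
  exact: correction_bound.
rewrite sumr_const -[leLHS]mulr_natl.
apply: (@le_trans _ _ ((l%:R ^+ 2 * n%:R ^+ (l - k.+1)) * ((alpha * n%:R) ^- l * ((2 * l%:R + 1) * B)))).
  apply: ler_wpM2r.
    by rewrite mulr_ge0 // mulr_ge0.
  by rewrite -!natrX -natrM ler_nat card_noninjective.
have -> : (l%:R ^+ 2 * n%:R ^+ (l - k.+1)) * ((alpha * n%:R) ^- l * ((2 * l%:R + 1) * B)) =
  l%:R ^+ 2 * (2 * l%:R + 1) * alpha ^- l / n%:R * B / (n%:R ^+ k).
  have -> : (alpha * n%:R) ^+ l = alpha ^+ l * (n%:R ^+ (l - k.+1) * (n%:R * n%:R ^+ k)).
    by rewrite exprMn -exprS -exprD subnK.
  have nn0 : n%:R != 0 :> R by rewrite gt_eqF.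
  have an0 : alpha != 0 by rewrite gt_eqF.
  move: (expf_neq0 l an0) (expf_neq0 (l - k.+1) nn0) (expf_neq0 k nn0).
  move: (alpha ^+ l) (n%:R ^+ (l - k.+1)) (n%:R ^+ k) => a b c a0 b0 c0.
  by field; rewrite nn0 a0 b0 c0.
apply: ler_wpM2l.
  have a0 : 0 <= alpha ^- l by rewrite invr_ge0 exprn_ge0 // ltW.
  by rewrite mulr_ge0 // mulr_ge0 ?invr_ge0 ?(ltW n0) // mulr_ge0 // mulr_ge0 // exprn_ge0.
by rewrite lef_pV2 ?posrE ?exprn_gt0 // -natrX ler_nat card_oriented_edge_le.
Qed.

(** Each orientation of [e] contributes [F e / N] up to [defect * B / N]: the sum over all closed
    sequences is governed by [closed_walk_estimate], and the non-injective ones are subtracted. *)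
Lemma cycle_weight_estimate e : e \in edges H ->
  `|\sum_(C in cycles l H | e \in edges C) cycle_weight F C - F e| <= defect * B.
Proof.
move=> eH; rewrite cycle_weight_total //.
have [o0 o0e] : exists o : oriented_edge H, support o = e.
  have : (0 < #|[set o : oriented_edge H | support o == e]|)%N by rewrite card_orientations ?fact_gt0.
  by case/card_gt0P => o; rewrite inE => /eqP <-; exists o.
have N0 : 0 < N by apply: card_gt0 o0.
pose G o := \sum_(v : {ffun 'I_l -> T} |
    closed_sequence H v && (window k v 0 == val o) && injectiveb v)
       closed_weight R H v * correction H F v.
have GE o : support o = e -> `|G o - F e / N| <= defect * B / N.
  move=> oe.
  have est := @closed_walk_estimate R S P (edge_walk_ge0 R (H:=H)) (edge_walk_row R k_gt0)
     (edge_walk_col R k_gt0) (fun x => F (support x)) B eps h l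
     (fun x => F_bound (support_edge x)) (edge_walk_reversible k_gt0 F) mixing le_2h_l o.
  rewrite -(@closed_sequence_sum R T k p H k_gt0 o F) (bigID (fun v : {ffun 'I_l -> T} => injectiveb v)) /= -/(G o) oe in est.
  have bad := noninjective_bound o.
  set X := \sum_(v | _ && ~~ _) _ in est bad.
  have -> : G o - F e / N = (G o + X - F e / N) - X by ring.
  rewrite (le_trans (ler_normB _ _)) // (le_trans (lerD est bad)) //.
  by rewrite /defect !mulrDl.
(* The edge [e] has [k!] orientations, and [N] is [k!] times the number of edges. *)
have Ek : (#|edges H|%:R : R) * \sum_(o : oriented_edge H | support o == e) N^-1 = 1.
  rewrite (eq_bigl (fun o => o \in [set o : oriented_edge H | support o == e])); last first.
    by move=> o; rewrite inE.
  rewrite sumr_const card_orientations // -[N^-1 *+ _]mulr_natl mulrA -natrM mulnC.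
  by rewrite -card_oriented_edges divff ?gt_eqF.
have -> : #|edges H|%:R * \sum_(o : oriented_edge H | support o == e) G o - F e =
   #|edges H|%:R * \sum_(o : oriented_edge H | support o == e) (G o - F e / N).
  by rewrite sumrB -mulr_sumr mulrBr mulrCA Ek mulr1.
rewrite normrM ger0_norm ?ler0n //.
have -> : defect * B = #|edges H|%:R * \sum_(o : oriented_edge H | support o == e) (defect * B / N).
  by rewrite -mulr_sumr mulrCA Ek mulr1.
rewrite ler_wpM2l ?ler0n // (le_trans (ler_norm_sum _ _ _)) // ler_sum // => o /eqP oe.
exact: GE.
Qed.

End Estimate.
End CycleWeights.

(** * Solving for prescribed totals *)

Section NearIdentity.
Variables (R : realFieldType) (I : finType).
Local Notation V := {ffun I -> R^o}.
Variables (L : {linear V -> V}) (c : R).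
Hypothesis c_lt1 : c < 1.
Hypothesis near_id :
  forall (f : V) B, (forall i, `|f i| <= B) -> forall i, `|L f i - f i| <= c * B.

(** The sup norm [B] of [f] satisfies [B <= b + c * B]. *)
Lemma near_identity_bound (f : V) b : (forall i, `|L f i| <= b) ->
  forall i, `|f i| <= b / (1 - c).
Proof.
move=> Lb i; have c1 : 0 < 1 - c by rewrite subr_gt0.
pose B := \big[Num.max/0]_j `|f j|.
have fB j : `|f j| <= B by exact: le_bigmax.
rewrite ler_pdivlMr //; apply: (@le_trans _ _ (B * (1 - c))); first by rewrite ler_wpM2r // ltW.
suff : B <= b + c * B by lra.
have b0 : 0 <= b by apply: le_trans (Lb i).
have cB0 : 0 <= c * B by apply: le_trans (near_id fB i).
apply: bigmax_le => [|j _]; first by rewrite addr_ge0.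
rewrite -[f j](subKr (L f j)) (le_trans (ler_normB _ _)) // lerD //.
exact: near_id.
Qed.

(** The bound with [b = 0] makes [L] injective, and the space has finite dimension. *)
Lemma near_identity_surjective (g : V) : exists f, L f = g.
Proof.
have ker0 : lker (linfun L) == 0%VS.
  apply/lker0P => u v; rewrite !lfunE => E.
  apply/eqP; rewrite -subr_eq0; apply/eqP/ffunP => i.
  have /near_identity_bound /(_ i) : forall j, `|L (u - v) j| <= 0.
    by move=> j; rewrite linearB E subrr ffunE normr0.
  by rewrite mul0r normr_le0 !ffunE => /eqP.
exists ((linfun L)^-1%VF g).
by have := lker0_lfunVK ker0 g; rewrite lfunE.
Qed.

End NearIdentity.

(** * Numerical estimates *)

Section Numerics.
Variable R : realType.
Implicit Types (x alpha mu : R).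

(* From expR (- 1 / 6) >= 5 / 6. *)
Lemma expR1_le3 : expR 1 <= 3 :> R.
Proof.
have -> : expR 1 = expR (1 / 6) ^+ 6 :> R by rewrite -expRM_natl; congr expR; field.
have h : expR (1 / 6) <= 6 / 5 :> R.
  rewrite -[1 / 6]opprK expRN -[leRHS]invrK lef_pV2 ?posrE ?expR_gt0 ?invr_gt0 ?divr_gt0 //.
  by apply: le_trans (expR_ge1Dx _); lra.
apply: (@le_trans _ _ ((6 / 5) ^+ 6)); last by lra.
by apply: lerXn2r; rewrite ?nnegrE ?expR_ge0 ?divr_ge0.
Qed.

Lemma ln_ge1 x : 3 <= x -> 1 <= ln x.
Proof.
move=> x3; have x0 : 0 < x by apply: lt_le_trans x3.
by rewrite -ler_expR lnK ?posrE // (le_trans expR1_le3).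
Qed.

(** With [z = x / 20 >= 18] the right side is [expR z ^+ 8 >= z ^+ 8], and [18 ^+ 6] exceeds
    [48 * 20 ^+ 2 = 19200]. *)
Lemma sqr_le_expR x : 360 <= x -> 48 * x ^+ 2 <= expR (2 / 5 * x).
Proof.
move=> x360; pose z := x / 20; have z18 : 18 <= z by rewrite /z; lra.
have -> : 2 / 5 * x = 8%:R * z by rewrite /z; field.
have -> : 48 * x ^+ 2 = 19200 * z ^+ 2 by rewrite /z; field.
clearbody z; clear x x360; have z0 : 0 <= z by apply: le_trans z18.
have hz : z <= expR z by apply: le_trans (expR_ge1Dx z); rewrite lerDr.
rewrite expRM_natl; apply: (@le_trans _ _ (z ^+ 6 * z ^+ 2)); last first.
  by rewrite -exprD; apply: lerXn2r; rewrite ?nnegrE ?expR_ge0.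
apply: ler_wpM2r; first exact: exprn_ge0.
apply: (@le_trans _ _ (18 ^+ 6)); first by rewrite -natrX ler_nat.
by rewrite lerXn2r ?nnegrE.
Qed.

(** The left side is at most [3 * v + 3 - x / 2], where [3 * v <= x / 60]; the bound [x >= 360]
    absorbs the constant 3. *)
Lemma exponent_sum x y z u v w : y + y <= u -> u <= v -> z <= v -> 180 * v <= x ->
  360 <= x -> x / 2 - 3 <= w -> 2 * y + u + z - w <= - (2 / 5 * x).
Proof. by move=> *; lra. Qed.

(** Used with [d.+1] equal to the connection length. The final 1 covers odd [l]. *)
Lemma half_quotient (l k d : nat) : (0 < d)%N -> (2 * k <= l)%N ->
  (l <= 2 * (((l./2 - k) %/ d).+1 * d.+1) + 2 * k + 1)%N.
Proof.
move=> d0 kl; have := ltn_ceil (l./2 - k) d0; have := odd_double_half l.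
have := leq_mul (leqnn ((l./2 - k) %/ d).+1) (leqnSn d).
move: (_.+1 * d)%N (_.+1 * d.+1)%N => q q'; move: (l./2) => h.
by case: (odd l); lia.
Qed.

(** The exponent is the number of blocks of [l0 - 1] steps that fit into half the cycle after [k]
    initial steps. It is about [l / (2 * l0)], so the power of [1 - alpha] is about [expR (- X / 2)]
    with [X = l * alpha / l0], and the hypothesis makes [X] large against [k * L * M]. *)
Lemma mixing_numerics alpha mu (l k l0 : nat) :
  0 < alpha -> alpha < 1 -> 0 < mu -> mu < 1 / 3 -> (2 <= k)%N -> (k + 1 <= l0)%N ->
  180 * k%:R * (l0%:R / alpha) * ln (l0%:R / alpha) * ln (1 / mu) <= l%:R ->
  (2 * k <= l)%N /\
  48 * l%:R ^+ 2 * ((1 - alpha) ^+ ((l./2 - k) %/ l0.-1) * alpha ^- k) <= mu.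
Proof.
move=> a0 a1 mu0 mu1 k2 kl0.
have l0_gt2 : (2 < l0)%N by lia.
have l0p : (0 < l0.-1)%N by lia.
set x := l0%:R / alpha; set L := ln x; set M := ln (1 / mu).
move=> hl.
have k2R : 2 <= k%:R :> R by rewrite ler_nat.
have l03 : 3 <= l0%:R :> R by rewrite ler_nat; lia.
have kl0R : k%:R + 1 <= l0%:R :> R by rewrite natr1 ler_nat; lia.
have ax : alpha^-1 <= x.
  by rewrite /x ler_peMl ?invr_ge0 ?(ltW a0) //; lra.
have l0x : l0%:R <= x.
  by rewrite /x ler_peMr ?ler0n // invf_ge1 // ltW.
have x3 : 3 <= x by lra.
have x0 : 0 < x by lra.
have L1 : 1 <= L by apply: ln_ge1.
have M1 : 1 <= M.
  by apply: ln_ge1; rewrite ler_pdivlMr //; lra.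
have expL : expR L = x by rewrite lnK.
have expM : expR M = mu^-1 by rewrite lnK ?posrE ?divr_gt0 // mul1r.
have hl' : 180 * (k%:R * L * M) <= l%:R / x.
  rewrite ler_pdivlMr //; apply: le_trans hl; rewrite le_eqVlt; apply/orP; left.
  by apply/eqP; ring.
set X := l%:R / x in hl'.
have kL : 2 <= k%:R * L by nra.
have kLM : k%:R * L <= k%:R * L * M by rewrite ler_peMr //; lra.
have X360 : 360 <= X by lra.
(* Since l = X expR L, the claim is that 48 X^2 expR (2 L + k L + M - alpha t) <= 1. *)
have lE : l%:R = X * x by rewrite /X divfK // gt_eqF.
have aXl : alpha * l%:R = X * l0%:R.
  by rewrite lE /x; field; rewrite gt_eqF.
have kleL : k%:R <= k%:R * L by rewrite ler_peMr ?ler0n.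
have lk : (2 * k <= l)%N.
  rewrite -(ler_nat R) natrM lE; have : X <= X * x by rewrite ler_peMr //; lra.
  by lra.
split=> //.
have := half_quotient l0p lk; rewrite prednK ?(ltnW (ltnW l0_gt2)) //.
move: ((l./2 - k) %/ l0.-1)%N => t tl.
(* Multiply the bound of [half_quotient] by [alpha] and divide by [l0], using [alpha * l = X * l0];
   the rounding terms add up to at most 4. *)
have at_ge : X / 2 - 3 <= alpha * t%:R.
  move: tl; rewrite -(ler_nat R).
  rewrite (_ : (_ + 1)%:R = 2 * ((t%:R + 1) * l0%:R) + 2 * k%:R + 1) => [h|]; last by ring.
  have h2 : X * l0%:R <= alpha * (2 * ((t%:R + 1) * l0%:R) + 2 * k%:R + 1).
    by rewrite -aXl ler_wpM2l // ltW.
  have h3 : alpha * (2 * k%:R + 1) <= 2 * l0%:R.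
    apply: (@le_trans _ _ (2 * k%:R + 1)); last by lra.
    by rewrite ler_piMl ?(ltW a1) //; lra.
  have h4 : alpha * (2 * l0%:R) <= 2 * l0%:R by rewrite ler_piMl ?(ltW a1) //; lra.
  have : X * l0%:R <= (2 * (alpha * t%:R) + 4) * l0%:R.
    have -> : (2 * (alpha * t%:R) + 4) * l0%:R =
      alpha * (2 * (t%:R * l0%:R)) + 4 * l0%:R by ring.
    by move: h2 h3 h4; rewrite !mulrDr !mulrDl !mul1r !mulrDr; lra.
  rewrite ler_pM2r; last by lra.
  by lra.
have pow_t : (1 - alpha) ^+ t <= expR (- (alpha * t%:R)).
  rewrite -mulNr expRM_natr lerXn2r ?nnegrE ?expR_ge0 //; first by lra.
  exact: expR_ge1Dx.
have pow_k : alpha ^- k <= expR (k%:R * L).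
  rewrite expRM_natl expL -exprVn lerXn2r ?nnegrE //; last by lra.
  by rewrite invr_ge0 ltW.
have expo : 2 * L + k%:R * L + M - alpha * t%:R <= - (2 / 5 * X).
  have kL2 : L + L <= k%:R * L by rewrite -mulr2n -[L *+ 2]mulr_natl ler_wpM2r // (le_trans _ L1).
  have M_le : M <= k%:R * L * M by rewrite ler_peMl ?(le_trans _ M1) // (le_trans _ kL) // ler1n.
  exact: exponent_sum kL2 kLM M_le hl' X360 at_ge.
have muE : mu = expR (- M) by rewrite expRN expM invrK.
apply: (@le_trans _ _ (48 * l%:R ^+ 2 * (expR (- (alpha * t%:R)) * expR (k%:R * L)))).
  apply: ler_wpM2l; first by rewrite mulr_ge0 // exprn_ge0.
  apply: ler_pM => //; first by rewrite exprn_ge0 // subr_ge0 ltW.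
  by rewrite invr_ge0 exprn_ge0 // ltW.
have -> : 48 * l%:R ^+ 2 * (expR (- (alpha * t%:R)) * expR (k%:R * L)) =
    48 * X ^+ 2 * expR (2 * L + k%:R * L - alpha * t%:R).
  rewrite lE -expL [2 * L]mulr_natl mulr2n !expRD; ring.
apply: le_trans (ler_wpM2r (expR_ge0 _) (sqr_le_expR X360)) _.
rewrite -expRD muE ler_expR -subr_ge0; move: expo; rewrite -subr_ge0.
by congr (0 <= _); ring.
Qed.

End Numerics.

(** * The total weight as a linear operator *)

Section Linearity.
Variables (R : realType) (T : finType) (k p : nat) (H : kgraph T k).
Local Notation l := p.+1.
Implicit Types (v : {ffun 'I_l -> T}) (F G : {set T} -> R) (C : kgraph T k) (a : R).

Lemma link_mean_linear a F G u :
  link_mean H (fun e => a * F e + G e) u = a * link_mean H F u + link_mean H G u.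
Proof. by rewrite /link_mean big_split -mulr_sumr mulrDl mulrA. Qed.

Lemma edge_mean_linear a F G :
  edge_mean H (fun e => a * F e + G e) = a * edge_mean H F + edge_mean H G.
Proof. by rewrite /edge_mean /mean big_split -mulr_sumr mulrDl mulrA. Qed.

Lemma correction_linear a F G v :
  correction H (fun e => a * F e + G e) v = a * correction H F v + correction H G v.
Proof.
rewrite /correction edge_mean_linear mulrDr addrACA mulr_sumr -big_split; congr (_ + _).
by apply: eq_bigr => i _; rewrite link_mean_linear /=; ring.
Qed.

Lemma cycle_weight_linear a F G C :
  cycle_weight p H (fun e => a * F e + G e) C = a * cycle_weight p H F C + cycle_weight p H G C.
Proof.
rewrite /cycle_weight mulrCA -mulrDr; congr (_ * _); rewrite mulr_sumr -big_split.
by apply: eq_bigr => v _; rewrite correction_linear /=; ring.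
Qed.

Definition cycle_total F e : R := \sum_(C in cycles l H | e \in edges C) cycle_weight p H F C.

Lemma cycle_total_linear a F G e :
  cycle_total (fun e => a * F e + G e) e = a * cycle_total F e + cycle_total G e.
Proof.
rewrite /cycle_total mulr_sumr -big_split.
by apply: eq_bigr => C _; rewrite cycle_weight_linear.
Qed.

(** Being the identity off [edges H], it is an operator near the identity on all functions on
    sets. *)
Definition total_operator (f : {ffun {set T} -> R^o}) : {ffun {set T} -> R^o} :=
  [ffun e => if e \in edges H then cycle_total f e else f e].

Lemma total_operator_linear : linear total_operator.
Proof.
move=> a f g; apply/ffunP => e; rewrite !ffunE; case: ifP => // _.
rewrite -[RHS]cycle_total_linear; congr (cycle_total _ _).
by apply/funext => e'; rewrite !ffunE.
Qed.

HB.instance Definition _ := GRing.isLinear.Build R _ _ _ total_operator total_operator_linear.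

End Linearity.

Section DegreeBounds.
Variables (T : finType) (k : nat) (H : kgraph T k) (X : {set T}).
Hypotheses (XH : X \subset vertices H) (cardX : #|X| = k.-1).

Lemma degree_le_max : (degree H X <= max_degree H)%N.
Proof. by apply: leq_bigmax_cond; rewrite XH cardX eqxx. Qed.

Lemma min_degree_le : (min_degree H <= degree H X)%N.
Proof.
rewrite /min_degree; have := mem_index_enum X; elim: (index_enum _) => // Y r IH.
rewrite inE big_cons => /orP[/eqP <-|/IH h].
  by rewrite XH cardX eqxx geq_minl.
by case: ifP => // _; rewrite geq_min h orbT.
Qed.

End DegreeBounds.

(** * Correcting the weights to total 1 *)

Section Correction.
Variables (R : realType) (T : finType) (k p : nat) (H : kgraph T k).
Local Notation l := p.+1.
Hypotheses (k_ge2 : (2 <= k)%N) (le_2k_l : (2 * k <= l)%N).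
Local Notation S := (oriented_edge H).
Local Notation N := (#|{: S}|%:R : R).
Local Notation n := #|vertices H|.
Local Notation P := (edge_walk R (H:=H)).
Variables (alpha eps mu : R) (m h : nat).
Hypotheses (alpha_gt0 : 0 < alpha) (alpha_lt1 : alpha < 1).
Hypothesis connected : walk_connected H alpha m.+2.
Hypothesis eps_ge0 : 0 <= eps.
Hypothesis mixing : forall j (x y : S), (h <= j)%N -> `|kpow P j x y - 1 / N| <= eps / N.
Hypothesis le_2h_l : (2 * h <= l)%N.
Hypothesis mu_lt : mu < 1 / 3.
Hypothesis small_defect : (2 * l%:R + 1) * (2 * defect p H alpha eps) <= mu.

Let k_gt0 : (0 < k)%N. Proof. by lia. Qed.
Local Notation c := (defect p H alpha eps).

Lemma defect_ge0 : 0 <= c.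
Proof.
rewrite addr_ge0 // ?mulr_ge0 ?addr_ge0 ?mulr_ge0 ?exprn_ge0 ?invr_ge0 ?ler0n //.
by rewrite exprn_ge0 // ltW.
Qed.

(** As [2 * l + 1 >= 3], smallness gives [6 * c <= mu < 1 / 3]. *)
Lemma defect_le_half : c <= 1 / 2.
Proof.
have c0 := defect_ge0.
have : 3 * (2 * c) <= (2 * l%:R + 1) * (2 * c).
  have l1 : 1 <= l%:R :> R by rewrite ler1n.
  by rewrite ler_wpM2r ?mulr_ge0 //; lra.
by move=> /le_trans/(_ small_defect) h3; have mu3 := mu_lt; lra.
Qed.

Lemma total_operator_near_id (f : {ffun {set T} -> R^o}) (B : R) :
  (forall e, `|f e| <= B) -> forall e, `|total_operator p H f e - f e| <= c * B.
Proof.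
move=> fB e; rewrite ffunE; case: ifP => eH; last first.
  by rewrite subrr normr0 mulr_ge0 ?defect_ge0 // (le_trans _ (fB e)).
by apply: (cycle_weight_estimate k_ge2 le_2k_l alpha_gt0 alpha_lt1 connected mixing le_2h_l).
Qed.

Lemma correction1 (v : {ffun 'I_l -> T}) : closed_sequence H v -> correction H (fun=> 1 : R) v = 1.
Proof.
move=> vc; pose o i : S := exist (fun t => t \in oriented_edges H) _ (window_oriented i vc).
rewrite /correction big1 => [|i _].
  rewrite addr0 /edge_mean /mean sum_const_card mulr1 divff //.
  by rewrite gt_eqF // (card_gt0 R (o 0)).
rewrite link_mean1 ?subrr //.
- exact: (codegree_back_gt0 R (o i)).
- exact: (uniq_back (o i)).
- exact: (size_back (o i)).
Qed.

(** Let [f] have all totals 1. The operator sends [f - 1] to a function of sup norm at most [c], so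
    [f - 1] is bounded by [c / (1 - c) <= 2 * c]. By linearity the correction moves from 1 by at
    most [(2 * l + 1) * (2 * c)]. *)
Lemma exists_correction : exists F : {set T} -> R,
  (forall e, e \in edges H -> cycle_total p H F e = 1) /\
  (forall v : {ffun 'I_l -> T}, closed_sequence H v -> `|correction H F v - 1| <= mu).
Proof.
have c12 := defect_le_half.
have c1 : c < 1 by lra.
have [f fE] := near_identity_surjective c1 total_operator_near_id ([ffun=> 1] : {ffun {set T} -> R^o}).
exists f; split=> [e eH|v vc].
  by have /ffunP/(_ e) := fE; rewrite !ffunE eH.
pose one : {ffun {set T} -> R^o} := [ffun=> 1].
have near_one e : `|(f - one) e| <= c / (1 - c).
  apply: (near_identity_bound c1 total_operator_near_id) => e'.
  have subE (a b : {ffun {set T} -> R^o}) : (a - b) e' = a e' - b e' by rewrite !ffunE.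
  rewrite linearB fE subE.
  have : `|total_operator p H one e' - one e'| <= c * 1.
    by apply: total_operator_near_id => i; rewrite ffunE normr1.
  by rewrite mulr1 distrC.
have c_le : c / (1 - c) <= 2 * c.
  have c0 := defect_ge0; rewrite ler_pdivrMr ?subr_gt0 //.
  by rewrite -mulrA mulrCA ler_peMr //; lra.
have -> : correction H f v - 1 = correction H (f - one) v.
  apply/eqP; rewrite subr_eq -[X in _ + X](correction1 vc); apply/eqP.
  rewrite -[X in X + _]mul1r -correction_linear; congr (correction _ _ _).
  by apply/funext => e; rewrite !ffunE mul1r subrK.
apply: le_trans small_defect.
apply: (correction_bound k_ge2 le_2k_l) => // e _.
exact: le_trans (near_one e) c_le.
Qed.

(** The [2 * l] parametrizations against the prefactor [e(H) / l] give [2 * e(H)]. Each closed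
    weight is a product of [l] inverse degrees of [(k-1)]-sets, and each correction is within [mu]
    of 1. *)
Lemma cycle_weight_bounds (F : {set T} -> R) C :
  (forall v : {ffun 'I_l -> T}, closed_sequence H v -> `|correction H F v - 1| <= mu) ->
  C \in cycles l H ->
  (1 - mu) * (2 * #|edges H|%:R / (max_degree H)%:R ^+ l) <= cycle_weight p H F C /\
  ((0 < min_degree H)%N ->
    cycle_weight p H F C <= (1 + mu) * (2 * #|edges H|%:R / (min_degree H)%:R ^+ l)).
Proof.
move=> Fmu Cl; have mu3 := mu_lt; have [v0 v0i CE] := cyclesP Cl.
pose A := [set v : {ffun 'I_l -> T} | injectiveb v && (cycle_of k v == C)].
have cardA : #|A| = (2 * l)%N by rewrite /A CE card_parametrizations.
have wE : cycle_weight p H F C = #|edges H|%:R / l%:R *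
    \sum_(v in A) closed_weight R H v * correction H F v.
  by rewrite /cycle_weight /A big_set.
have l0 : 0 < l%:R :> R by rewrite ltr0n.
(* Both bounds become sums over the parametrizations, to be compared termwise. *)
have twoE (x y : R) : x * (2 * #|edges H|%:R / y) =
    #|edges H|%:R / l%:R * \sum_(v in A) y^-1 * x.
  rewrite sumr_const cardA -[y^-1 * x *+ _]mulr_natl natrM.
  by move: (l%:R) l0 (y^-1) => L L0 z; field; rewrite gt_eqF.
have closed v : v \in A -> closed_sequence H v.
  rewrite inE => /andP[vi /eqP vC].
  by rewrite /closed_sequence -(cycle_of_cycles k_ge2) // vC.
have deg (v : {ffun 'I_l -> T}) i : closed_sequence H v ->
    (min_degree H <= degree H [set a in behead (window k v i)] <= max_degree H)%N.
  move=> vc; pose o : S := exist (fun t => t \in oriented_edges H) _ (window_oriented i vc).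
  have cardX : #|[set a in behead (window k v i)]| = k.-1.
    by rewrite cardsE (card_uniqP (uniq_back o)) size_back.
  have XH : [set a in behead (window k v i)] \subset vertices H.
    by apply/subsetP => a; rewrite inE => /mem_behead; apply: (oriented_vertex (x := o)).
  by rewrite min_degree_le ?degree_le_max.
have deg_gt0 (v : {ffun 'I_l -> T}) i : closed_sequence H v -> 0 < codegree R H (behead (window k v i)).
  move=> vc; pose o : S := exist (fun t => t \in oriented_edges H) _ (window_oriented i vc).
  exact: (codegree_back_gt0 R o).
rewrite wE !twoE; split=> [|d0].
  apply: ler_wpM2l; first by rewrite divr_ge0.
  apply: ler_sum => v /closed vc; have := Fmu v vc; rewrite ler_norml => /andP[h1 _].
  apply: ler_pM; [by rewrite invr_ge0 exprn_ge0|by lra| |by lra].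
  rewrite -exprVn -[X in _ ^+ X <= _](card_ord l) -prodr_const.
  apply: ler_prod => i _; rewrite invr_ge0 ler0n /=.
  have /andP[_ dM] := deg v i vc; have d0 := deg_gt0 v i vc.
  by rewrite lef_pV2 ?posrE // /codegree ?ler_nat // (lt_le_trans d0) // /codegree ler_nat.
apply: ler_wpM2l; first by rewrite divr_ge0.
apply: ler_sum => v /closed vc; have := Fmu v vc; rewrite ler_norml => /andP[h1 h2].
apply: ler_pM; [exact: closed_weight_ge0|by lra| |by lra].
rewrite -exprVn -[X in _ <= _ ^+ X](card_ord l) -prodr_const.
apply: ler_prod => i _; rewrite invr_ge0 ler0n /=.
have /andP[dm _] := deg v i vc.
by rewrite lef_pV2 ?posrE ?deg_gt0 ?ltr0n // /codegree ler_nat.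
Qed.

End Correction.

(** * Assembly of the decomposition *)

Lemma edgeless_decomposition (R : realType) (T : finType) (k l : nat) (H : kgraph T k) :
  edges H = set0 -> fractional_cycle_decomposition l H (fun=> 0 : R).
Proof. by move=> E; split=> [C _|e]; rewrite ?lexx ?ler01 // E inE. Qed.

(** Each cycle contains an edge, whose nonnegative weights sum to 1, so no weight exceeds 1. *)
Lemma decomposition_of_total (R : realType) (T : finType) (k p : nat) (H : kgraph T k)
    (w : kgraph T k -> R) : (2 <= k)%N -> (2 * k <= p.+1)%N ->
  (forall C, C \in cycles p.+1 H -> 0 <= w C) ->
  (forall e, e \in edges H -> \sum_(C in cycles p.+1 H | e \in edges C) w C = 1) ->
  fractional_cycle_decomposition p.+1 H w.
Proof.
move=> k2 kl w0 w1; split=> // C Cl; rewrite w0 //=.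
have [v vi CE] := cyclesP Cl; have vinj := injectiveP _ vi.
have eC : winset k v 0 \in edges C by rewrite CE (edges_cycle_of k2 kl).
have eH : winset k v 0 \in edges H.
  by have := Cl; rewrite {1}CE cycle_of_cycles // => /forallP.
rewrite -(w1 _ eH) (bigD1 C) ?Cl //= lerDl sumr_ge0 // => C' /andP[/andP[C'l _] _].
exact: w0.
Qed.

(* If min_degree H = 0, the upper bound is infinite, i.e. void; it has to be
   guarded because x / 0 = 0 here. *)
Theorem theorem1p4 (R : realType) (alpha mu : R) (l k : nat)
    (alpha_gt0 : 0 < alpha) (alpha_lt1 : alpha < 1)
    (mu_gt0 : 0 < mu) (mu_lt : mu < 1 / 3)
    (l_ge2 : (2 <= l)%N) (k_ge2 : (2 <= k)%N) :
  exists n0 : nat, forall n : nat, (n0 <= n)%N ->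
  forall (T : finType) (H : kgraph T k), #|vertices H| = n ->
  forall l0 : nat, (k + 1 <= l0)%N ->
  walk_connected H alpha l0 ->
  180 * k%:R * (l0%:R / alpha) * ln (l0%:R / alpha) * ln (1 / mu) <= l%:R ->
  exists w : kgraph T k -> R,
    fractional_cycle_decomposition l H w /\
    forall C, C \in cycles l H ->
      (1 - mu) * (2 * #|edges H|%:R / (max_degree H)%:R ^+ l) <= w C /\
      ((0 < min_degree H)%N ->
       w C <= (1 + mu) * (2 * #|edges H|%:R / (min_degree H)%:R ^+ l)).
Proof.
case: l l_ge2 => // p l_ge2.
(* [K / n] is the part of [(2 * l + 1) * (2 * defect)] due to repeated vertices; the choice of [n0]
   makes it at most [mu / 2]. *)
pose K : R := (2 * p.+1%:R + 1) * (2 * (p.+1%:R ^+ 2 * (2 * p.+1%:R + 1) * alpha ^- p.+1)).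
have K0 : 0 <= K.
  have a0 : 0 <= alpha ^- p.+1 by rewrite invr_ge0 exprn_ge0 // ltW.
  have L0 : 0 <= 2 * p.+1%:R + 1 :> R by rewrite addr_ge0 ?mulr_ge0 ?ler0n.
  by rewrite /K mulr_ge0 // mulr_ge0 // mulr_ge0 // mulr_ge0 // exprn_ge0.
exists (Num.bound (2 * K / mu)) => n n0n T H nE [|[|m]] kl0; [by lia|by lia|move=> conn hl].
have k_gt0 : (0 < k)%N by apply: ltnW.
have [lk eps_small] := mixing_numerics alpha_gt0 alpha_lt1 mu_gt0 mu_lt k_ge2 kl0 hl.
have [E|/set0Pn[e0 e0H]] := eqVneq (edges H) set0.
  exists (fun=> 0); split; first exact: edgeless_decomposition.
  by move=> C _; rewrite E cards0 mulr0n mulr0 !mul0r !mulr0 lexx.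
have [o0 _] : exists o : oriented_edge H, support o == e0.
  have : (0 < #|[set o : oriented_edge H | support o == e0]|)%N.
    by rewrite card_orientations ?fact_gt0.
  by case/card_gt0P => o; rewrite inE; exists o.
have n_gt0 : 0 < n%:R :> R by rewrite ltr0n -nE (vertices_gt0 k_gt0 o0).
(* The walk has to be mixed after half the cycle: [k] steps for the majorization, then [t] blocks of
   [m.+1] steps. *)
pose t := (((p.+1)./2 - k) %/ m.+1)%N.
pose eps : R := (1 - alpha) ^+ t * alpha ^- k.
have eps_ge0 : 0 <= eps.
  by rewrite mulr_ge0 ?exprn_ge0 ?subr_ge0 ?invr_ge0 ?exprn_ge0 ?ltW.
have kh : (k <= (p.+1)./2)%N by rewrite geq_half_double -muln2 mulnC.
have mixing j (x y : oriented_edge H) : ((p.+1)./2 <= j)%N ->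
    `|kpow (edge_walk R (H:=H)) j x y - 1 / #|{: oriented_edge H}|%:R| <=
    eps / #|{: oriented_edge H}|%:R.
  move=> hj; apply: (kpow_mixing (edge_walk_ge0 R (H := H)) (edge_walk_row R k_gt0)
    (edge_walk_col R k_gt0) (edge_walk_minorization k_gt0 conn)
    (edge_walk_majorization k_gt0 alpha_gt0 alpha_lt1 conn)).
  by rewrite (leq_trans _ hj) // addnC -leq_subRL // leq_divM.
have hh : (2 * (p.+1)./2 <= p.+1)%N by rewrite mulnC muln2 -{2}(odd_double_half p.+1) leq_addl.
have small : (2 * p.+1%:R + 1) * (2 * defect p H alpha eps) <= mu.
  rewrite /defect nE.
  have L1 : 1 <= p.+1%:R :> R by rewrite ler1n.
  have h1 : 2 * K / mu <= n%:R.
    apply: le_trans (ltW (archi_boundP _)) _; last by rewrite ler_nat.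
    by apply: divr_ge0 (ltW mu_gt0); apply: mulr_ge0.
  have h2 : K / n%:R <= mu / 2.
    rewrite ler_pdivrMr //; move: h1; rewrite ler_pdivrMr // => h1; lra.
  (* For [l >= 1] the factor [(2 * l + 1) * 2 * (2 * l + 2)] of [eps] is at most [24 * l ^ 2]. *)
  have h3 : 24 * p.+1%:R ^+ 2 * eps <= mu / 2.
    have -> : mu / 2 = 1 / 2 * mu by ring.
    have -> : 24 * p.+1%:R ^+ 2 * eps = 1 / 2 * (48 * p.+1%:R ^+ 2 * eps) by field.
    apply: ler_wpM2l eps_small; exact: divr_ge0.
  have -> : (2 * p.+1%:R + 1) * (2 * ((2 * p.+1%:R + 2) * eps +
      p.+1%:R ^+ 2 * (2 * p.+1%:R + 1) * alpha ^- p.+1 / n%:R)) =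
    (2 * p.+1%:R + 1) * (2 * (2 * p.+1%:R + 2)) * eps + K / n%:R.
    by rewrite /K; ring.
  have -> : mu = mu / 2 + mu / 2 by field.
  apply: lerD => //; apply: le_trans h3; apply: ler_wpM2r => //.
  by move: (p.+1%:R : R) L1 => L L1; rewrite expr2; nra.
have [F [F1 Fmu]] := exists_correction k_ge2 lk alpha_gt0 alpha_lt1 conn eps_ge0 mixing hh mu_lt small.
have bounds := cycle_weight_bounds k_ge2 lk mu_lt Fmu.
exists (cycle_weight p H F); split=> //.
apply: decomposition_of_total => // C /bounds[lower _].
apply: le_trans lower; rewrite mulr_ge0 ?mulr_ge0 ?invr_ge0 ?exprn_ge0 ?ler0n //.
lra.
Qed.
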